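(* Let $\mathcal{H}\neq\{0\}$ be a separable complex Hilbert space. Identify the three sets $\mathcal{P}(\mathcal{H})$ (rays), $S/S^1$ (unit rays) and $\partial_e\mathcal{S}(\mathcal{H})$ (one-dimensional orthogonal projections) by means of the natural bijections $[\varphi]\mapsto\left[\frac{\varphi}{\|\varphi\|}\right]_S$ from $\mathcal{P}(\mathcal{H})$ onto $S/S^1$ and $[\chi]_S\mapsto P_\chi=|\chi\rangle\langle\chi|$ from $S/S^1$ onto $\partial_e\mathcal{S}(\mathcal{H})$. Under these identifications, all of the following topologies coincide: the quotient topologies $\mathcal{T}_\mu$ and $\mathcal{T}_\nu$; the weak topologies $\mathcal{T}_0,\mathcal{T}_w,\mathcal{T}_1,\mathcal{T}_2,\mathcal{T}_3,\mathcal{T}_4,\mathcal{T}_5,\mathcal{T}_s$; and the metric topologies $\mathcal{T}_n$ and $\mathcal{T}_{\mathrm{tr}}$.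
   Context: Sets. $\mathcal{H}^*:=\mathcal{H}\setminus\{0\}$ and $S:=\{\varphi\in\mathcal{H}\mid\|\varphi\|=1\}$ carry the topologies induced by the norm of $\mathcal{H}$. $\mathcal{P}(\mathcal{H})$ is the set of equivalence classes (rays) $[\varphi]$ of $\varphi\in\mathcal{H}^*$, two vectors being equivalent iff they differ by a nonzero complex factor. $S/S^1$ is the set of equivalence classes (unit rays) $[\chi]_S$ of $\chi\in S$, two unit vectors being equivalent iff they differ by a phase factor $\lambda\in\mathbb{C}$, $|\lambda|=1$. $\mathcal{S}(\mathcal{H})$ is the convex set of positive trace-class operators of trace $1$, and $\partial_e\mathcal{S}(\mathcal{H})$ is the set of its extreme points, i.e. the set of all one-dimensional orthogonal projections $P_\varphi=|\varphi\rangle\langle\varphi|$, $\|\varphi\|=1$. Spaces of operators. $\mathcal{T}_s(\mathcal{H})$, $\mathcal{C}_s(\mathcal{H})$, $\mathcal{B}_s(\mathcal{H})$ denote the real Banach spaces of self-adjoint trace-class operators (trace norm), compact self-adjoint operators (operator norm), and bounded self-adjoint operators (operator norm) on $\mathcal{H}$. Via $(A,B)\mapsto\mathrm{tr}\,AB$ one has $(\mathcal{C}_s(\mathcal{H}))'=\mathcal{T}_s(\mathcal{H})$ and $(\mathcal{T}_s(\mathcal{H}))'=\mathcal{B}_s(\mathcal{H})$. For a dual pair, $\sigma(X,Y)$ denotes the coarsest topology on $X$ making all functionals given by elements of $Y$ continuous, and $\sigma(X,Y)\cap\partial_e\mathcal{S}(\mathcal{H})$ its restriction (subspace topology) to $\partial_e\mathcal{S}(\mathcal{H})$.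 Topologies. $\mathcal{T}_\mu$ is the quotient topology on $\mathcal{P}(\mathcal{H})$ for $\mu:\mathcal{H}^*\to\mathcal{P}(\mathcal{H})$, $\mu(\varphi)=[\varphi]$. $\mathcal{T}_\nu$ is the quotient topology on $S/S^1$ for $\nu:S\to S/S^1$, $\nu(\chi)=[\chi]_S$. The following are topologies on $\partial_e\mathcal{S}(\mathcal{H})$: $\mathcal{T}_0$ is the coarsest topology making all functions $h_Q:P\mapsto\mathrm{tr}\,PQ$, $Q\in\partial_e\mathcal{S}(\mathcal{H})$, continuous; $\mathcal{T}_w$ and $\mathcal{T}_s$ are the restrictions of the weak and the strong operator topology, respectively; $\mathcal{T}_1:=\sigma(\mathcal{C}_s(\mathcal{H}),\mathcal{T}_s(\mathcal{H}))\cap\partial_e\mathcal{S}(\mathcal{H})$; $\mathcal{T}_2:=\sigma(\mathcal{T}_s(\mathcal{H}),\mathcal{C}_s(\mathcal{H}))\cap\partial_e\mathcal{S}(\mathcal{H})$; $\mathcal{T}_3:=\sigma(\mathcal{T}_s(\mathcal{H}),\mathcal{B}_s(\mathcal{H}))\cap\partial_e\mathcal{S}(\mathcal{H})$; $\mathcal{T}_4:=\sigma(\mathcal{B}_s(\mathcal{H}),\mathcal{T}_s(\mathcal{H}))\cap\partial_e\mathcal{S}(\mathcal{H})$; $\mathcal{T}_5:=\sigma(\mathcal{B}_s(\mathcal{H}),(\mathcal{B}_s(\mathcal{H}))')\cap\partial_e\mathcal{S}(\mathcal{H})$; $\mathcal{T}_n$ and $\mathcal{T}_{\mathrm{tr}}$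 are the topologies of the metrics $\rho_n(P,Q)=\|P-Q\|$ (operator norm) and $\rho_{\mathrm{tr}}(P,Q)=\|P-Q\|_{\mathrm{tr}}$ (trace norm). *)

(* Defs.v *)
(* A complex Hilbert space is a complete normed module H over R[i], R : realType,
   with a form ip : {dot H for conjC} such that ip x x = `|x| ^+ 2 (a hypothesis
   where it is needed). As in sesquilinear.v, ip is linear
   in its FIRST argument and antilinear in the second: ip x y is the physicists'
   <y | x>. *)
From HB Require Import structures.
From mathcomp Require Import all_boot all_order all_algebra.
From mathcomp Require Import complex sesquilinear.
From mathcomp Require Import all_classical all_reals all_analysis.

Set Implicit Arguments.
Unset Strict Implicit.
Unset Printing Implicit Defensive.

Import Order.TTheory GRing.Theory Num.Theory numFieldNormedType.Exports.
Local Open Scope classical_set_scope.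
Local Open Scope ring_scope.
Local Open Scope complex_scope.
Local Open Scope quotient_scope.

Section Topologies.

(* In this section a topology on T is represented by its family of open sets. *)

Definition coarsest_topology (T : choiceType) (I : Type) (U : topologicalType)
    (f : I -> T -> U) : set (set T) :=
  @open (sup_topology (fun i => Topological.on (initial_topology (f i)))).

(* The subspace topology of Y, for Y `<=` X: the sets Y `&` V, V in tau, seen as
   subsets of the type Y. *)
Definition restrict_topology (T : Type) (X : set T) (tau : set (set X))
    (Y : set T) : set (set Y) :=
  [set U | exists2 V, tau V & U = [set y : Y | (set_val @` V) (set_val y)]].

Definition metric_topology (R : realType) (T : Type) (d : T -> T -> R) :
    set (set T) :=
  [set U | forall x, U x ->
     exists2 e, 0 < e & forall y, d x y < e -> U y].

(* The topology transported along a bijection h : S -> T. *)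
Definition transport_topology (S T : Type) (h : S -> T) (tau : set (set S)) :
    set (set T) :=
  [set U | tau (h @^-1` U)].

End Topologies.

Arguments restrict_topology {T} X tau Y.

Section Rays.
Context (R : realType) (H : completeNormedModType R[i]).

Definition separable_space := exists D : set H, countable D /\ dense D.

(* As types, these carry the topology induced by the norm (subtype_topology.v). *)
Definition nonzero_vectors : set H := [set x | x != 0].
Definition unit_sphere : set H := [set x | `|x| = 1].

Definition ray_equiv (x y : nonzero_vectors) : bool :=
  `[< exists2 c : R[i], c != 0 & set_val x = c *: set_val y >].

Lemma ray_equiv_refl : reflexive ray_equiv.
Proof. by move=> x; apply/asboolP; exists 1; rewrite ?oner_neq0 ?scale1r. Qed.

Lemma ray_equiv_sym : symmetric ray_equiv.
Proof.
suff imp x y : ray_equiv x y -> ray_equiv y x.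
  by move=> x y; apply/idP/idP; exact: imp.
move=> /asboolP[c c0 xy]; apply/asboolP; exists c^-1; first by rewrite invr_eq0.
by rewrite xy scalerA mulVf// scale1r.
Qed.

Lemma ray_equiv_trans : transitive ray_equiv.
Proof.
move=> y x z /asboolP[c c0 xy] /asboolP[d d0 yz]; apply/asboolP.
by exists (c * d); rewrite ?mulf_neq0// xy yz scalerA.
Qed.

Canonical ray_equiv_rel :=
  EquivRel ray_equiv ray_equiv_refl ray_equiv_sym ray_equiv_trans.

Definition projective_space : topologicalType :=
  quotient_topology {eq_quot ray_equiv_rel}.

Definition ray (x : nonzero_vectors) : projective_space :=
  \pi_{eq_quot ray_equiv_rel} x.

Definition phase_equiv (x y : unit_sphere) : bool :=
  `[< exists2 c : R[i], `|c| = 1 & set_val x = c *: set_val y >].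

Lemma phase_equiv_refl : reflexive phase_equiv.
Proof. by move=> x; apply/asboolP; exists 1; rewrite ?normr1 ?scale1r. Qed.

Lemma phase_equiv_sym : symmetric phase_equiv.
Proof.
suff imp x y : phase_equiv x y -> phase_equiv y x.
  by move=> x y; apply/idP/idP; exact: imp.
move=> /asboolP[c c1 xy]; apply/asboolP.
have c0 : c != 0 by rewrite -normr_eq0 c1 oner_neq0.
by exists c^-1; rewrite ?normfV ?c1 ?invr1// xy scalerA mulVf// scale1r.
Qed.

Lemma phase_equiv_trans : transitive phase_equiv.
Proof.
move=> y x z /asboolP[c c1 xy] /asboolP[d d1 yz]; apply/asboolP.
by exists (c * d); rewrite ?normrM ?c1 ?d1 ?mulr1// xy yz scalerA.
Qed.

Canonical phase_equiv_rel :=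
  EquivRel phase_equiv phase_equiv_refl phase_equiv_sym phase_equiv_trans.

Definition unit_rays : topologicalType :=
  quotient_topology {eq_quot phase_equiv_rel}.

Definition unit_ray (x : unit_sphere) : unit_rays :=
  \pi_{eq_quot phase_equiv_rel} x.

Lemma normalize_subproof (x : nonzero_vectors) :
  `|set_val x|^-1 *: set_val x \in unit_sphere.
Proof.
case: x => x x0; rewrite set_valE inE /unit_sphere /=.
have {}x0 : x != 0 by move: x0; rewrite inE.
by rewrite normrZ normfV normr_id mulVf// normr_eq0.
Qed.

Definition normalize (x : nonzero_vectors) : unit_sphere :=
  exist _ (`|set_val x|^-1 *: set_val x) (normalize_subproof x).

End Rays.

Arguments nonzero_vectors {R} H _.
Arguments unit_sphere {R} H _.

Section Operators.
Context (R : realType) (H : completeNormedModType R[i]).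
Context (ip : {dot H for Num.conj}).
Implicit Types (A B T : H -> H) (x y : H).

Definition bounded_operator A :=
  linear A /\ exists M : R, forall x, `|A x| <= M%:C * `|x|.

Definition compact_operator A :=
  bounded_operator A /\ compact (closure (A @` [set x | `|x| <= 1])).

Definition self_adjoint A := forall x y, ip (A x) y = ip x (A y).

(* On R[i], 0 <= z means that z is real and nonnegative. *)
Definition positive_operator A := forall x, 0 <= ip (A x) x.

Definition op_norm A : R :=
  sup [set complex.Re `|A x| | x in [set x | `|x| <= 1]].

(* Orthonormal bases are enumerated by nat. Some terms of the sequence may be 0,
   so that finite-dimensional spaces are covered as well; every enumeration of an
   orthonormal basis, padded with zeroes, is of this form, and the zero terms do
   not contribute to the sum defining the trace. *)
Definition orthonormal_basis (e : nat -> H) :=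
  [/\ forall n, e n = 0 \/ `|e n| = 1,
      forall m n, m <> n -> ip (e m) (e n) = 0 &
      dense [set x | exists n (c : nat -> R[i]), x = \sum_(i < n) c i *: e i]].

Definition has_trace A (t : R[i]) :=
  forall e, orthonormal_basis e ->
    series (fun n => ip (A (e n)) (e n) : R[i]^o) @ \oo --> (t : R[i]^o).

(* The default value 0 is never used for trace-class operators. *)
Definition trace A : R[i] := xget 0 [set t | has_trace A t].

(* T = |A| = (A^* A)^(1/2): T is positive and T^2 = A^* A. *)
Definition is_absolute_value A T :=
  [/\ bounded_operator T, positive_operator T &
      forall x y, ip (T (T x)) y = ip (A x) (A y)].

Definition has_trace_norm A (t : R[i]) :=
  exists2 T, is_absolute_value A T & has_trace T t.

Definition trace_class A := bounded_operator A /\ exists t, has_trace_norm A t.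

Definition trace_norm A : R := complex.Re (xget 0 [set t | has_trace_norm A t]).

Definition Bounded : set (H -> H) := [set A | bounded_operator A].
Definition Bs : set (H -> H) := [set A | bounded_operator A /\ self_adjoint A].
Definition Cs : set (H -> H) := [set A | compact_operator A /\ self_adjoint A].
Definition Ts : set (H -> H) := [set A | trace_class A /\ self_adjoint A].

Definition density_operators : set (H -> H) :=
  [set A | [/\ trace_class A, positive_operator A & trace A = 1]].

Definition extreme_points (K : set (H -> H)) : set (H -> H) :=
  [set A | K A /\ forall B C (t : R), K B -> K C -> 0 < t -> t < 1 ->
     A = t%:C *: B + (1 - t)%:C *: C -> B = A /\ C = A].

Definition pure_states : set (H -> H) := extreme_points density_operators.

(* P_x = |x><x|. *)
Definition rank_one x : H -> H := fun z => ip z x *: x.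

(* tr (A B); it is a real number when A and B are self-adjoint and one of them
   is of trace class, so that taking the real part loses nothing in the weak
   topologies below. *)
Definition trace_pairing A B : R := complex.Re (trace (A \o B)).

(* sigma(X, Y) for the duality (A, B) |-> tr (A B). *)
Definition sigma (X Y : set (H -> H)) : set (set X) :=
  coarsest_topology (fun (B : Y) (A : X) => trace_pairing (set_val A) (set_val B)).

(* The topological dual of the real Banach space Bs. *)
Definition Bs_dual : set (Bs -> R) :=
  [set F | (forall (a : R) (A B C : Bs),
              set_val C = a%:C *: set_val A + set_val B -> F C = a * F A + F B) /\
           exists M : R, forall A : Bs, `|F A| <= M * op_norm (set_val A)].

Definition weak_operator_topology : set (set Bounded) :=
  coarsest_topology
    (fun (xy : H * H) (A : Bounded) => ip (set_val A xy.1) xy.2 : R[i]^o).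

Definition strong_operator_topology : set (set Bounded) :=
  coarsest_topology (fun (x : H) (A : Bounded) => set_val A x).

Definition T_0 : set (set pure_states) :=
  coarsest_topology
    (fun Q P : pure_states => trace_pairing (set_val P) (set_val Q)).
Definition T_w := restrict_topology Bounded weak_operator_topology pure_states.
Definition T_s := restrict_topology Bounded strong_operator_topology pure_states.
Definition T_1 := restrict_topology Cs (@sigma Cs Ts) pure_states.
Definition T_2 := restrict_topology Ts (@sigma Ts Cs) pure_states.
Definition T_3 := restrict_topology Ts (@sigma Ts Bs) pure_states.
Definition T_4 := restrict_topology Bs (@sigma Bs Ts) pure_states.
Definition T_5 :=
  restrict_topology Bs (coarsest_topology (fun F : Bs_dual => set_val F)) pure_states.
Definition T_n : set (set pure_states) :=
  metric_topology (fun P Q : pure_states => op_norm (set_val P - set_val Q)).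
Definition T_tr : set (set pure_states) :=
  metric_topology (fun P Q : pure_states => trace_norm (set_val P - set_val Q)).

Definition T_mu : set (set (projective_space H)) := open.
Definition T_nu : set (set (unit_rays H)) := open.

End Operators.

Arguments T_0 {R H} ip _.
Arguments T_w {R H} ip _.
Arguments T_s {R H} ip _.
Arguments T_1 {R H} ip _.
Arguments T_2 {R H} ip _.
Arguments T_3 {R H} ip _.
Arguments T_4 {R H} ip _.
Arguments T_5 {R H} ip _.
Arguments T_n {R H} ip _.
Arguments T_tr {R H} ip _.
Arguments T_mu {R} H _.
Arguments T_nu {R} H _.

(* Main.v *)
(* Identify a pure state with a unit vector [x] up to phase, [P_x = |x><x|]. Each of
   the topologies is shown to have as open sets the sets [U] of pure states such that
   [{x | P_x in U}] is open in the unit sphere.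

   Write [s = sqrt (1 - |<x, y>|^2)]. The difference [D = P_x - P_y] satisfies
   [D^3 = s^2 D], so that [||D|| = s], [|D| = D^2 / s] and [||D||_tr = 2 s]. Moreover
   [s <= ||x - y||], while [||x - c y||^2 <= 2 s^2] for a suitable phase [c]; this
   settles the metric and the quotient topologies. A topology that is initial for
   functions [f_i] agrees with that of the metric [s] as soon as every [f_i] is
   continuous in the unit vector [x] and the transition probability
   [|<x, y>|^2 = 1 - s^2] can be read off continuously from one of the [f_i (P_y)]. *)
Require Import Defs.
From HB Require Import structures.
From mathcomp Require Import all_boot all_order all_algebra.
From mathcomp Require Import complex sesquilinear.
From mathcomp Require Import all_classical all_reals all_analysis.
From mathcomp Require Import ring lra.

Set Implicit Arguments.
Unset Strict Implicit.
Unset Printing Implicit Defensive.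

Import Order.TTheory GRing.Theory Num.Theory numFieldNormedType.Exports.
Local Open Scope classical_set_scope.
Local Open Scope ring_scope.
Local Open Scope complex_scope.

(** * Positive and bounded operators *)

Section ComplexNumbers.
Context (R : realType).
Implicit Types (z w : R[i]).

Lemma ge0_ReE z : 0 <= z -> z = (complex.Re z)%:C.
Proof. by move=> /ger0_real /RRe_real. Qed.

Lemma Re_ge0 z : 0 <= z -> 0 <= complex.Re z.
Proof. by move=> z0; rewrite -ler0c -ge0_ReE. Qed.

Lemma norm_real_complex (r : R) : `|r%:C| = `|r|%:C.
Proof. by rewrite normc_def /= expr0n /= addr0 sqrtr_sqr. Qed.

Lemma conj_ge0E z : 0 <= z -> Num.conj z = z.
Proof. by move=> /ger0_real /conj_Creal. Qed.

Lemma normr_Re_le z : `|complex.Re z|%:C <= `|z|.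
Proof.
rewrite normc_def lecR -sqrtr_sqr ler_wsqrtr// lerDl sqr_ge0 //.
Qed.

Lemma Re_continuous : continuous (@complex.Re R : R[i]^o -> R).
Proof.
move=> z; apply/(@cvgrPdist_lt _ _ _ _ (nbhs_filter (z : R[i]^o))) => e e0.
have /cvgrPdist_lt/(_ e%:C) : (fun w : R[i]^o => w) @ (z : R[i]^o) --> (z : R[i]^o).
  exact: cvg_id.
rewrite ltcR => /(_ e0); apply: filterS => w.
by rewrite -raddfB -ltcR; apply: le_lt_trans (normr_Re_le _).
Qed.

End ComplexNumbers.

(** * Inner products, positive operators and the Cauchy-Schwarz inequality *)

Section InnerProduct.
Context (R : realType) (H : completeNormedModType R[i]).
Context (ip : {dot H for Num.conj}).
Implicit Types (x y z u v w : H) (a b c : R[i]) (A B T : H -> H).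

Definition nrm x : R := complex.Re `|x|.

Lemma nrmE x : `|x| = (nrm x)%:C.
Proof. exact: ge0_ReE. Qed.

Lemma nrm_ge0 x : 0 <= nrm x.
Proof. exact: Re_ge0. Qed.

Lemma ler_nrmB x y : `|nrm x - nrm y| <= nrm (x - y).
Proof.
have nrmD u v : nrm (u + v) <= nrm u + nrm v.
  by rewrite -lecR rmorphD /= -!nrmE ler_normD.
have nrmBC u v : nrm (u - v) = nrm (v - u) by rewrite /nrm distrC.
have := nrmD (x - y) y; have := nrmD (y - x) x; rewrite !subrK (nrmBC y).
by rewrite ler_norml; lra.
Qed.

Lemma ipDl x y z : ip (x + y) z = ip x z + ip y z.
Proof. exact: linearDl. Qed.
Lemma ipBl x y z : ip (x - y) z = ip x z - ip y z.
Proof. exact: linearBl. Qed.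
Lemma ipZl a x z : ip (a *: x) z = a * ip x z.
Proof. exact: linearZl_LR. Qed.
Lemma ipDr x y z : ip x (y + z) = ip x y + ip x z.
Proof. exact: linearDr. Qed.
Lemma ipBr x y z : ip x (y - z) = ip x y - ip x z.
Proof. exact: linearBr. Qed.
Lemma ipZr a x z : ip x (a *: z) = Num.conj a * ip x z.
Proof. exact: linearZr_LR. Qed.
Lemma ip0l x : ip 0 x = 0. Proof. exact: linear0l. Qed.
Lemma ip0r x : ip x 0 = 0. Proof. exact: linear0r. Qed.
Lemma ipC x y : ip x y = Num.conj (ip y x).
Proof. by rewrite hermC expr0 mul1r. Qed.
Lemma ip_suml n (F : 'I_n -> H) z : ip (\sum_i F i) z = \sum_i ip (F i) z.
Proof. exact: linear_sumlz. Qed.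

Context (ip_norm : forall x, ip x x = `|x| ^+ 2).

Lemma ip_ge0 x : 0 <= ip x x.
Proof. by rewrite ip_norm exprn_ge0. Qed.

Lemma ip_eq0 x : ip x x = 0 -> x = 0.
Proof. by move=> /eqP; rewrite ip_norm expf_eq0 /= normr_eq0 => /eqP. Qed.

Lemma eq_ip x y : (forall z, ip x z = ip y z) -> x = y.
Proof.
by move=> xy; apply/eqP; rewrite -subr_eq0; apply/eqP/ip_eq0; rewrite ipBl xy subrr.
Qed.

Lemma linear_opB A x y : linear A -> A (x - y) = A x - A y.
Proof. by move=> Al; rewrite addrC -scaleN1r Al scaleN1r addrC. Qed.
Lemma linear_opD A x y : linear A -> A (x + y) = A x + A y.
Proof. by move=> Al; rewrite -[x]scale1r Al !scale1r. Qed.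
Lemma linear_op0 A : linear A -> A 0 = 0.
Proof. by move=> /(linear_opB 0 0); rewrite !subrr. Qed.
Lemma linear_opZ A a x : linear A -> A (a *: x) = a *: A x.
Proof. by move=> Al; rewrite -[a *: x]addr0 Al linear_op0// addr0. Qed.

(** Polarization: the sesquilinear form [h] vanishes on the diagonal because [<A z, z>] is real.
    Expanding at [x + y] makes [h] antisymmetric, and replacing [y] by [i y] makes it symmetric as
    well. *)
Lemma positive_self_adjoint A : linear A -> positive_operator ip A ->
  self_adjoint ip A.
Proof.
move=> Al Ap x y.
pose h x y := ip (A x) y - ip x (A y).
have hxx z : h z z = 0.
  by rewrite /h [ip z _]ipC (conj_ge0E (Ap z)) subrr.
have hD u v : h u v + h v u = 0.
  rewrite -[RHS](hxx (u + v)) /h linear_opD// !ipDl !ipDr.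
  by move: (hxx u) (hxx v); rewrite /h => /subr0_eq-> /subr0_eq->; ring.
have := hD x ('i%C *: y); rewrite /h linear_opZ// !ipZl !ipZr.
have -> : Num.conj ('i%C : R[i]) = - 'i%C by rewrite /Num.conj /=; simpc.
move=> ih.
have {ih} hh : h x y - h y x = 0.
  apply: (@mulfI _ (- 'i%C)).
    by rewrite oppr_eq0; apply/eqP => -[] /eqP; rewrite oner_eq0.
  by rewrite mulr0 -[RHS]ih /h; ring.
have : h x y *+ 2 = 0.
  by rewrite -[RHS]addr0 -[X in _ = X + _](hD x y) -[X in _ = _ + X]hh; ring.
by move/eqP; rewrite mulrn_eq0 /= subr_eq0 => /eqP.
Qed.

(** Expand [<A (x - s y), x - s y> >= 0] and choose [s]. For [c != 0] the minimizer [s = b / c]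
    gives the claim after multiplication by [c]. *)
Lemma positive_CauchySchwarz A x y : linear A -> positive_operator ip A ->
  `|ip (A x) y| ^+ 2 <= ip (A x) x * ip (A y) y.
Proof.
move=> Al Ap; have As := positive_self_adjoint Al Ap.
set a := ip (A x) x; set b := ip (A x) y; set c := ip (A y) y.
have a0 : 0 <= a := Ap x.
have c0 : 0 <= c := Ap y.
have bC : ip (A y) x = Num.conj b by rewrite As ipC.
have key s : 0 <= a - Num.conj s * b - s * Num.conj b + s * Num.conj s * c.
  have := Ap (x - s *: y); rewrite linear_opB// linear_opZ// !ipBl !ipBr.
  by rewrite !ipZl !ipZr -/a -/b -/c bC; congr (0 <= _); ring.
rewrite normCK.
have [c_eq0|c_neq0] := eqVneq c 0.
  rewrite c_eq0 mulr0; have [->|b0] := eqVneq b 0; first by rewrite mul0r.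
  have bb : b * Num.conj b != 0 by rewrite mulf_neq0// conjC_eq0.
  have tR : Num.conj ((a + 1) / (b * Num.conj b)) = (a + 1) / (b * Num.conj b).
    apply: conj_ge0E; rewrite divr_ge0 ?addr_ge0//.
    by rewrite -normCK exprn_ge0.
  (* With [c = 0] there is no quadratic term in [s]; this multiple of [b] brings the expression down
     to [- (a + 2) < 0], so [b] has to vanish. *)
  have := key ((a + 1) / (b * Num.conj b) * b).
  rewrite rmorphM /= tR c_eq0 mulr0 addr0.
  set t := _ / _.
  have -> : a - t * Num.conj b * b - t * b * Num.conj b = - (a + 2).
    have : t * (b * Num.conj b) = a + 1 by rewrite /t divfK.
    move=> tE; transitivity (a - 2 * (t * (b * Num.conj b))); first by ring.
    by rewrite tE; ring.
  rewrite oppr_ge0 => /(lt_le_trans (ltr_wpDl a0 (ltr0Sn _ 1))).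
  by rewrite ltxx.
have {}c0 : 0 < c by rewrite lt_def c_neq0.
have := key (b / c); rewrite rmorphM fmorphV /= (conj_ge0E (ltW c0)).
rewrite -(pmulr_lge0 _ c0) => key0; rewrite -subr_ge0; congr (0 <= _): key0; field.
exact: c_neq0.
Qed.

Lemma ler_norm_ip x y : `|ip x y| <= `|x| * `|y|.
Proof.
rewrite -(@ler_pXn2r _ 2)// ?nnegrE ?mulr_ge0//.
rewrite exprMn -!ip_norm; exact: (@positive_CauchySchwarz id).
Qed.

Lemma positive_kernel A x : linear A -> positive_operator ip A ->
  ip (A x) x = 0 -> A x = 0.
Proof.
move=> Al Ap Ax; apply: eq_ip => z; rewrite ip0l.
have := positive_CauchySchwarz x z Al Ap; rewrite Ax mul0r => h.
have : `|ip (A x) z| ^+ 2 == 0 by rewrite eq_le h exprn_ge0.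
by rewrite expf_eq0 /= normr_eq0 => /eqP.
Qed.

Lemma bounded_operator_pos A : bounded_operator A ->
  exists2 M : R, 0 < M & forall x, `|A x| <= M%:C * `|x|.
Proof.
move=> [Al [M AM]]; exists (Num.max M 1); first by rewrite lt_max ltr01 orbT.
move=> x; apply: le_trans (AM x) _; apply: ler_wpM2r => //.
by rewrite lecR le_max lexx.
Qed.

(** * Continuity of bounded operators, the norm and the inner product *)

Section Convergence.
Context {T : Type} {F : set_system T} {FF : Filter F}.

Lemma cvg_bounded_operator A (f : T -> H) x : bounded_operator A ->
  f @ F --> x -> A \o f @ F --> A x.
Proof.
move=> /[dup] -[Al _] /bounded_operator_pos[M M0 AM] fx.
apply/cvgrPdist_lt => e e0; near=> t.
rewrite /= -linear_opB//; apply: le_lt_trans (AM _) _.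
rewrite mulrC -ltr_pdivlMr ?ltcR//; near: t.
by apply: cvgr_dist_lt => //; rewrite divr_gt0 ?ltcR.
Unshelve. all: by end_near. Qed.

Lemma cvg_nrm (f : T -> H) x : f @ F --> x -> (fun t => nrm (f t)) @ F --> nrm x.
Proof.
move=> /cvgrPdist_lt fx; apply/cvgrPdist_lt => e e0.
apply: filterS (fx e%:C _); last by rewrite ltcR.
by move=> t; rewrite nrmE ltcR; apply: le_lt_trans; exact: ler_nrmB.
Qed.

Lemma cvg_dist_nrm (f : T -> H) x :
  f @ F --> x -> (fun t => nrm (f t - x)) @ F --> (0 : R).
Proof.
move=> /cvgrPdist_lt fx; apply/cvgrPdist_lt => e e0.
apply: filterS (fx e%:C _); last by rewrite ltcR.
by move=> t; rewrite sub0r normrN distrC nrmE ltcR ger0_norm ?nrm_ge0.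
Qed.

Lemma cvg_ip (f g : T -> H) x y : f @ F --> x -> g @ F --> y ->
  (fun t => ip (f t) (g t) : R[i]^o) @ F --> (ip x y : R[i]^o).
Proof.
move=> fx gy.
(* A real majorant of [|<f, g> - <x, y>|], from the splitting [<f - x, g> + <x, g - y>]. *)
have : (fun t => nrm (f t - x) * nrm (g t) + nrm x * nrm (g t - y)) @ F
    --> 0 * nrm y + nrm x * 0.
  apply: cvgD; apply: cvgM.
  - exact: cvg_dist_nrm.
  - exact: cvg_nrm.
  - exact: cvg_cst.
  - exact: cvg_dist_nrm.
rewrite mul0r mulr0 addr0 => /cvgrPdist_lt bound.
apply/(@cvgrPdist_lt _ R[i]^o _ F FF) => e e0.
have e0' : 0 < complex.Re e by rewrite -ltcR -ge0_ReE// ltW.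
apply: filterS (bound _ e0') => t.
rewrite sub0r normrN ger0_norm ?addr_ge0 ?mulr_ge0 ?nrm_ge0// -ltcR -ge0_ReE ?ltW//.
apply: le_lt_trans; rewrite distrC rmorphD !rmorphM /= -!nrmE.
have -> : ip (f t) (g t) - ip x y = ip (f t - x) (g t) + ip x (g t - y).
  by rewrite ipBl ipBr addrA subrK.
by rewrite (le_trans (ler_normD _ _))// lerD// ler_norm_ip.
Qed.

End Convergence.

End InnerProduct.

(** * Orthonormal bases and traces *)

Section Trace.
Context (R : realType) (H : completeNormedModType R[i]).
Context (ip : {dot H for Num.conj}).
Context (ip_norm : forall x, ip x x = `|x| ^+ 2).
Implicit Types (x y z u v w : H) (a b c : R[i]) (A B T : H -> H) (e : nat -> H).

Definition fourier_sum e n x := \sum_(i < n) ip x (e i) *: e i.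

(** Orthogonality is asked only below [n], so that the lemma applies in the middle of the
    Gram-Schmidt induction. If [e k = 0], both sides vanish. *)
Lemma ip_fourier_sum e n x k :
  (forall i, e i = 0 \/ `|e i| = 1) ->
  (forall i j, (i < n)%N -> (j < n)%N -> i <> j -> ip (e i) (e j) = 0) ->
  (k < n)%N -> ip (fourier_sum e n x) (e k) = ip x (e k).
Proof.
move=> e01 eO kn; rewrite /fourier_sum ip_suml (bigD1 (Ordinal kn))//= ipZl.
rewrite big1 ?addr0.
  case: (e01 k) => [->|ek]; first by rewrite !ip0r mulr0.
  by rewrite ip_norm ek expr1n mulr1.
move=> i ik; rewrite ipZl eO ?mulr0// => iE.
by move: ik; rewrite -val_eqE /= iE eqxx.
Qed.

Lemma ip_sumr_eq0 x n (c : nat -> R[i]) e :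
  (forall i, (i < n)%N -> ip x (e i) = 0) ->
  ip x (\sum_(i < n) c i *: e i) = 0.
Proof.
move=> xe; rewrite ipC ip_suml big1 ?conjC0// => i _.
by rewrite ipZl ipC xe// conjC0 mulr0.
Qed.

Lemma pythagoras_ler x y : ip x y = 0 -> `|x| <= `|x + y|.
Proof.
move=> xy; rewrite -(@ler_pXn2r _ 2)// ?nnegrE// -!ip_norm ipDl !ipDr xy.
by rewrite (ipC _ y) xy conjC0 addr0 add0r lerDl ip_norm exprn_ge0.
Qed.

(** The residual of the Fourier sum is orthogonal to [e i] for [i < n], hence to the difference of
    the Fourier sum and the other combination; Pythagoras concludes. *)
Lemma fourier_sum_best e n m x (c : nat -> R[i]) : orthonormal_basis ip e ->
  (m <= n)%N -> `|x - fourier_sum e n x| <= `|x - \sum_(i < m) c i *: e i|.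
Proof.
move=> [e01 eO _] mn.
have xSe i : (i < n)%N -> ip (x - fourier_sum e n x) (e i) = 0.
  by move=> ni; rewrite ipBl ip_fourier_sum// ?subrr// => j k _ _; exact: eO.
set v := \sum_(i < m) _; set S := fourier_sum e n x in xSe *.
have -> : x - v = (x - S) + (S - v) by rewrite addrA subrK.
apply: pythagoras_ler; rewrite ipBr.
rewrite {2}/S /fourier_sum (ip_sumr_eq0 (fun i => ip x (e i)))// sub0r.
by rewrite ip_sumr_eq0 ?oppr0// => i im; exact/xSe/(leq_trans im).
Qed.

(** Density gives one combination of [m] terms close to [x]; by best approximation every Fourier sum
    with [n >= m] is at least as close. *)
Lemma fourier_sum_cvg e x : orthonormal_basis ip e ->
  (fun n => fourier_sum e n x) @ \oo --> x.
Proof.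
move=> /[dup] eB [_ _ ed]; apply/cvgrPdist_lt => eps eps0.
have xeps : nbhs x (ball x eps) by exact: nbhsx_ballx.
have [||v [/interior_subset xv [m [c vE]]]] := ed (ball x eps)^°.
- by exists x; exact: xeps.
- exact: open_interior.
near=> n; apply: le_lt_trans (fourier_sum_best (m := m) x c eB _) _.
  by near: n; exact: nbhs_infty_ge.
by rewrite -vE; move: xv; rewrite -ball_normE.
Unshelve. all: by end_near. Qed.

(* [e n = 0] when [d n] depends linearly on the previous vectors. *)
Lemma exists_gram_schmidt (d : nat -> H) :
  exists e : nat -> H, forall n,
    let y := d n - fourier_sum e n (d n) in e n = `|y|^-1 *: y.
Proof.
pose orth (s : seq H) x :=
  let y := x - \sum_(u <- s) ip x u *: u in `|y|^-1 *: y.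
(* Each vector depends on all earlier ones, so the recursion carries the list of them; [gsE]
   identifies it with an initial segment of [e]. *)
pose gs := fix gs n := if n is m.+1 then rcons (gs m) (orth (gs m) (d m)) else [::].
pose e n := orth (gs n) (d n).
have gsE n : gs n = mkseq e n 
  by elim: n => // n IH; rewrite /= -[orth _ _]/(e n) IH mkseqS.
exists e => n /=; rewrite {1}/e /orth gsE /fourier_sum.
by rewrite big_map -(big_mkord xpredT (fun i => ip (d n) (e i) *: e i)) /index_iota subn0.
Qed.

(** Gram-Schmidt is applied to an enumeration [d] of a countable dense set; [d n] lies in the span
    of [e 0, ..., e n], so this span is dense too. *)
Lemma exists_orthonormal_basis :
  separable_space H -> exists e, orthonormal_basis ip e.
Proof.
move=> [D [/countable_injP[f f_inj] Dd]].
(* Indices outside the image of [D] receive the vector 0, which leads to [e n = 0], as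
   [orthonormal_basis] permits. *)
pose d n := xget 0 [set x | D x /\ f x = n].
have dD x : D x -> d (f x) = x.
  move=> Dx; rewrite /d; case: xgetP => [y _ [Dy fxy]|/(_ x) []//].
  by apply: f_inj; rewrite ?inE.
have [e eE] := exists_gram_schmidt d.
have e01 n : e n = 0 \/ `|e n| = 1.
  rewrite eE; set y := _ - _; have [->|y0] := eqVneq y 0.
    by rewrite scaler0; left.
  by right; rewrite normrZ normfV normr_id mulVf// normr_eq0.
have eO n : forall i j, (i < n)%N -> (j < n)%N -> i <> j -> ip (e i) (e j) = 0.
  elim: n => // n IH.
  have en j : (j < n)%N -> ip (e n) (e j) = 0.
    by move=> jn; rewrite eE ipZl ipBl ip_fourier_sum// subrr mulr0.
  move=> i j; rewrite ltnS (leq_eqVlt i) ltnS (leq_eqVlt j).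
  move=> /predU1P[->|ni] /predU1P[->|nj] ij //.
  - exact: en.
  - by rewrite ipC en// conjC0.
  - exact: IH.
exists e; split => //.
  by move=> m n mn; apply: (eO (maxn m n).+1) => //; rewrite ltnS leq_max leqnn ?orbT.
move=> O O0 Oo; have [x [Ox Dx]] := Dd O O0 Oo; exists x; split => //.
rewrite -(dD x Dx); set n := f x.
(* The last coefficient undoes the normalization of [e n]. *)
exists n.+1, (fun i => if i == n then `|d n - fourier_sum e n (d n)| else ip (d n) (e i)).
rewrite big_ord_recr /= eqxx eE scalerA.
set y := _ - _; transitivity (fourier_sum e n (d n) + y).
  by rewrite addrC subrK.
congr (_ + _).
  by apply: eq_bigr => i _; rewrite ltn_eqF.
have [->|y0] := eqVneq y 0; first by rewrite scaler0.
by rewrite mulfV ?scale1r// normr_eq0.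
Qed.

Lemma linear_op_fourier_sum B e n x : linear B ->
  B (fourier_sum e n x) = \sum_(i < n) ip x (e i) *: B (e i).
Proof.
move=> Bl; rewrite /fourier_sum; elim: n => [|n IH].
  by rewrite !big_ord0 linear_op0.
by rewrite !big_ord_recr/= linear_opD// linear_opZ// IH.
Qed.

(** In any basis the partial sums of the trace are [<B S_n, x>], with [S_n] the Fourier sums of [x];
    continuity of [B] gives the limit. All traces below reduce to this one. *)
Lemma has_trace_rank_one_comp x B : bounded_operator B ->
  has_trace ip (rank_one ip x \o B) (ip (B x) x).
Proof.
move=> /[dup] -[Bl _] Bb e eB.
have h : (fun n => ip (B (fourier_sum e n x)) x : R[i]^o) @ \oo --> (ip (B x) x : R[i]^o).
  apply: cvg_ip => //; last exact: cvg_cst.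
  have h0 := @fourier_sum_cvg e x eB.
  exact: (cvg_bounded_operator Bb h0).
apply: cvg_trans h; apply: near_eq_cvg; near=> n.
rewrite /series /= linear_op_fourier_sum// ip_suml big_mkord.
by apply: eq_bigr => i _; rewrite /rank_one !ipZl mulrC.
Unshelve. all: by end_near. Qed.

Lemma has_trace_comb a b A B (t u : R[i]) : has_trace ip A t -> has_trace ip B u ->
  has_trace ip (fun z => a *: A z + b *: B z) (a * t + b * u).
Proof.
move=> At Bu e eB.
have h : (fun n => a * series (fun n => ip (A (e n)) (e n) : R[i]^o) n +
    b * series (fun n => ip (B (e n)) (e n) : R[i]^o) n : R[i]^o) @ \oo -->
    (a * t + b * u : R[i]^o).
  apply: (@cvgD _ R[i]^o).
    exact: (@cvgMl_tmp _ _ _ _ _ (a : R[i]^o) _ (At e eB)).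
  exact: (@cvgMl_tmp _ _ _ _ _ (b : R[i]^o) _ (Bu e eB)).
apply: cvg_trans h; apply: near_eq_cvg; near=> n.
rewrite /series /= !mulr_sumr -big_split /=; apply: eq_bigr => i _.
by rewrite ipDl !ipZl.
Unshelve. all: by end_near. Qed.

Context (H_separable : separable_space H).

(** Since [has_trace] quantifies over all bases, uniqueness rests on the existence of one; this is
    where separability enters. *)
Lemma has_trace_unique A (t u : R[i]) : has_trace ip A t -> has_trace ip A u -> t = u.
Proof.
have [e eB] := exists_orthonormal_basis H_separable.
move=> /(_ e eB) At /(_ e eB) Au.
by apply: (@cvg_unique R[i]^o (@norm_hausdorff _ R[i]^o) _ _ t u At Au).
Qed.

Lemma traceE A t : has_trace ip A t -> trace ip A = t.
Proof.
by move=> At; rewrite /trace; case: xgetP => [u _ Au|/(_ t)//]; exact: has_trace_unique Au At.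
Qed.

End Trace.

(** * Differences of one-dimensional projections *)

Section RankOne.
Context (R : realType) (H : completeNormedModType R[i]).
Context (ip : {dot H for Num.conj}).
Context (ip_norm : forall x, ip x x = `|x| ^+ 2).
Implicit Types (x y z u v w : H) (a b c : R[i]) (A B C D T : H -> H) (e : nat -> H).

Lemma ip_nrm x : ip x x = (nrm x ^+ 2)%:C.
Proof. by rewrite ip_norm nrmE rmorphXn. Qed.

Lemma unit_ip x : `|x| = 1 -> ip x x = 1.
Proof. by rewrite ip_norm => ->; rewrite expr1n. Qed.

Lemma linear_comb a b A B : linear A -> linear B ->
  linear (fun z => a *: A z + b *: B z).
Proof.
move=> Al Bl k u v; rewrite Al Bl !scalerDr !scalerA.
by rewrite (mulrC a) (mulrC b) addrACA.
Qed.

Lemma bounded_operator_comb a b A B : bounded_operator A -> bounded_operator B ->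
  bounded_operator (fun z => a *: A z + b *: B z).
Proof.
move=> [Al [M AM]] [Bl [N BN]]; split; first exact: linear_comb.
have real_norm c : exists k : R, `|c| = k%:C.
  by exists (complex.Re `|c|); exact: ge0_ReE.
have [[k kE] [l lE]] := (real_norm a, real_norm b).
exists (k * M + l * N) => x.
rewrite rmorphD !rmorphM /= -kE -lE mulrDl.
by rewrite (le_trans (ler_normD _ _))// lerD// normrZ -mulrA ler_wpM2l.
Qed.

Lemma bounded_operatorB A B : bounded_operator A -> bounded_operator B ->
  bounded_operator (A - B).
Proof.
move=> Ab Bb; have := bounded_operator_comb 1 (-1) Ab Bb; congr bounded_operator.
by apply/funext => z; rewrite scale1r scaleN1r.
Qed.

Lemma op_norm_le A (M : R) : 0 <= M -> (forall x, `|A x| <= M%:C * `|x|) ->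
  op_norm A <= M.
Proof.
move=> M0 AM; apply: ge_sup.
  by exists (nrm (A 0)), 0 => //=; rewrite normr0.
move=> _ [x /= x1 <-]; rewrite -lecR -/(nrm _) -nrmE (le_trans (AM x))//.
by rewrite ler_piMr// ler0c.
Qed.

Lemma nrm_le_op_norm A x : bounded_operator A -> `|x| <= 1 -> nrm (A x) <= op_norm A.
Proof.
move=> /bounded_operator_pos[M M0 AM] x1; apply: ub_le_sup; last by exists x.
exists M => _ [y /= y1 <-]; rewrite -lecR -/(nrm _) -nrmE (le_trans (AM y))//.
by rewrite ler_piMr// ler0c ltW.
Qed.

Notation P := (rank_one ip).

Lemma rank_one_linear x : linear (P x).
Proof. by move=> a u v; rewrite /rank_one ipDl ipZl scalerDl scalerA. Qed.

Lemma rank_one_bounded x : bounded_operator (P x).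
Proof.
split; first exact: rank_one_linear.
exists (nrm x ^+ 2) => z; rewrite /rank_one normrZ rmorphXn /= -nrmE.
rewrite expr2 mulrAC ler_wpM2r// [leRHS]mulrC; exact: (ler_norm_ip ip_norm).
Qed.

Lemma rank_one_positive x : positive_operator ip (P x).
Proof.
by move=> z; rewrite /rank_one ipZl (ipC _ x) -normCK exprn_ge0.
Qed.

Lemma rank_one_self_adjoint x : self_adjoint ip (P x).
Proof. by move=> u v; rewrite /rank_one ipZl ipZr -ipC mulrC. Qed.

Lemma rank_one_unit x : `|x| = 1 -> P x x = x.
Proof. by move=> x1; rewrite /rank_one unit_ip// scale1r. Qed.

Lemma rank_one_phase c x : `|c| = 1 -> P (c *: x) = P x.
Proof.
move=> c1; apply/funext => z; rewrite /rank_one ipZr scalerA mulrAC.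
by rewrite [_^*%R * c]mulrC -normCK c1 expr1n mul1r.
Qed.

Lemma rank_one_inj x y : `|x| = 1 -> `|y| = 1 -> P x = P y ->
  exists2 c, `|c| = 1 & x = c *: y.
Proof.
move=> x1 y1 xy; have xE : x = ip x y *: y.
  by rewrite -[LHS](rank_one_unit x1) xy.
exists (ip x y) => //.
by have := x1; rewrite {1}xE normrZ y1 mulr1.
Qed.

Lemma has_trace_rank_one x : has_trace ip (P x) (ip x x).
Proof.
have idb : bounded_operator (@id H) by split=> //; exists 1 => z; rewrite mul1r.
exact: (has_trace_rank_one_comp ip_norm idb).
Qed.

Lemma is_absolute_value_positive A : bounded_operator A ->
  positive_operator ip A -> is_absolute_value ip A A.
Proof.
move=> /[dup] -[Al _] Ab Ap; split=> // x y; exact: positive_self_adjoint.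
Qed.

Lemma positive_trace_class A t : bounded_operator A -> positive_operator ip A ->
  has_trace ip A t -> trace_class ip A.
Proof.
by move=> Ab Ap At; split=> //; exists t, A => //; exact: is_absolute_value_positive.
Qed.

(** For [y = A x - B x], commutation gives [(A + B) y = A^2 x - B^2 x = 0]. Hence [<A y, y>] and
    [<B y, y>] vanish, so [A y = B y = 0], and [<y, y> = <x, A y - B y> = 0]. *)
Lemma positive_sqrt_unique A B : linear A -> linear B ->
  positive_operator ip A -> positive_operator ip B ->
  (forall x, A (A x) = B (B x)) -> (forall x, A (B x) = B (A x)) -> A = B.
Proof.
move=> Al Bl Ap Bp sq comm; apply/funext => x.
have Bs := positive_self_adjoint Bl Bp.
have As := positive_self_adjoint Al Ap.
set y := A x - B x.
have AB0 : A y + B y = 0.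
  by rewrite /y (linear_opB _ _ Al) (linear_opB _ _ Bl) sq comm addrA subrK subrr.
have /eqP : ip (A y) y + ip (B y) y = 0 by rewrite -ipDl AB0 ip0l.
rewrite paddr_eq0; [|exact: Ap|exact: Bp] => /andP[/eqP Ay /eqP By].
apply/subr0_eq/(ip_eq0 ip_norm); rewrite -/y {1}/y ipBl As Bs.
by rewrite (positive_kernel ip_norm Al Ap Ay) (positive_kernel ip_norm Bl Bp By) subrr.
Qed.

(** The transition probability [|<x, y>|^2], which is also the trace of [P_x P_y]. *)
Definition overlap x y : R := complex.Re (ip x y * ip y x).

Lemma overlapE x y : ip x y * ip y x = (overlap x y)%:C.
Proof. by apply: ge0_ReE; rewrite (ipC _ y) -normCK exprn_ge0. Qed.

Lemma overlapC x y : overlap x y = overlap y x.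
Proof. by rewrite /overlap mulrC. Qed.

Lemma overlap_le1 x y : `|x| = 1 -> `|y| = 1 -> overlap x y <= 1.
Proof.
move=> x1 y1; rewrite -lecR -overlapE (ipC _ y) -normCK exprn_ile1//.
by rewrite (le_trans (ler_norm_ip ip_norm _ _))// x1 y1 mulr1.
Qed.

(** For unit vectors, the sine of the angle between the complex lines that they span. *)
Definition gap x y : R := Num.sqrt (1 - overlap x y).

Lemma gap_sqr x y : `|x| = 1 -> `|y| = 1 -> gap x y ^+ 2 = 1 - overlap x y.
Proof. by move=> x1 y1; rewrite sqr_sqrtr// subr_ge0 overlap_le1. Qed.

Lemma gap_ge0 x y : 0 <= gap x y.
Proof. exact: sqrtr_ge0. Qed.

(** * Operator norm and trace norm of [P_x - P_y] *)

Section Difference.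
Context (x y : H) (x1 : `|x| = 1) (y1 : `|y| = 1).
Let D := P x - P y.
Let s := gap x y.

Let DE z : D z = P x z - P y z. Proof. by []. Qed.

Let Dl : linear D.
Proof. by have [] := bounded_operatorB (rank_one_bounded x) (rank_one_bounded y). Qed.

Let sE : (s ^+ 2)%:C = 1 - ip x y * ip y x.
Proof. by rewrite gap_sqr// overlapE rmorphB. Qed.

Let Dx : D x = x - ip x y *: y.
Proof. by rewrite DE rank_one_unit. Qed.

Let Dy : D y = ip y x *: x - y.
Proof. by rewrite DE (rank_one_unit y1). Qed.

Let DDx : D (D x) = (s ^+ 2)%:C *: x.
Proof.
rewrite Dx (linear_opB _ _ Dl) (linear_opZ _ _ Dl) Dx Dy sE scalerBr scalerBl scale1r scalerA.
by rewrite opprB addrA subrK.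
Qed.

Let DDy : D (D y) = (s ^+ 2)%:C *: y.
Proof.
rewrite Dy (linear_opB _ _ Dl) (linear_opZ _ _ Dl) Dx Dy sE scalerBr scalerBl scale1r scalerA.
by rewrite opprB [ip y x * _]mulrC addrC addrA subrK.
Qed.

(** The range of [D] lies in the span of [x] and [y], on which [D^2] is multiplication by [s^2]. *)
Let DDD z : D (D (D z)) = (s ^+ 2)%:C *: D z.
Proof.
have Dlin a b u v : D (a *: u - b *: v) = a *: D u - b *: D v.
  by rewrite (linear_opB _ _ Dl) !(linear_opZ _ _ Dl).
have Dz : D z = ip z x *: x - ip z y *: y by [].
have DDz : D (D z) = ip z x *: D x - ip z y *: D y by exact: Dlin.
have -> : D (D (D z)) = ip z x *: D (D x) - ip z y *: D (D y).
  by rewrite DDz; exact: Dlin.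
by rewrite DDx DDy Dz scalerBr !scalerA ![(s ^+ 2)%:C * _]mulrC.
Qed.

Let Ds : self_adjoint ip D.
Proof. by move=> u v; rewrite !DE ipBl ipBr !rank_one_self_adjoint. Qed.

(** From [D^3 = s^2 D] one gets [||D^2 z|| = s ||D z||], and [||D z||^2 = <D^2 z, z>] then yields
    [||D z|| <= s ||z||] by Cauchy-Schwarz. The bound is attained at [x]. *)
Lemma op_norm_rank_oneB : op_norm (P x - P y) = gap x y.
Proof.
apply/eqP; rewrite eq_le; apply/andP; split.
  apply: op_norm_le; first exact: gap_ge0.
  move=> z; rewrite -/D -/s !nrmE -rmorphM /= lecR.
  set n := nrm (D z).
  have n0 : 0 <= n by exact: nrm_ge0.
  have nDD : nrm (D (D z)) = s * n.
    apply/eqP; rewrite -(@eqrXn2 _ 2)// ?mulr_ge0 ?gap_ge0 ?nrm_ge0//.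
    by apply/eqP/complexI; rewrite -ip_nrm -Ds DDD ipZl ip_nrm -rmorphM /= exprMn.
  have : n ^+ 2 <= s * n * nrm z.
    have := ler_norm_ip ip_norm (D (D z)) z.
    by rewrite Ds ip_nrm norm_real_complex ger0_norm ?sqr_ge0// !nrmE nDD -rmorphM lecR.
  have [->|n_neq0] := eqVneq n 0; first by rewrite mulr_ge0 ?gap_ge0 ?nrm_ge0.
  by rewrite expr2 mulrAC ler_pM2r// lt_def n_neq0.
rewrite -/s; have <- : nrm (D x) = s.
  apply/eqP; rewrite -(@eqrXn2 _ 2)// ?gap_ge0 ?nrm_ge0//.
  by apply/eqP/complexI; rewrite -ip_nrm -Ds DDx ipZl unit_ip// mulr1.
apply: nrm_le_op_norm; last by rewrite x1.
exact: bounded_operatorB (rank_one_bounded x) (rank_one_bounded y).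
Qed.

(* [T0] is [|D|], also for [s = 0]: then [D = 0] and [s^-1 = 0]. *)
Let T0 z := (s^-1)%:C *: D (D z).

Let T0T0 z : T0 (T0 z) = D (D z).
Proof.
have DDZ a u : D (D (a *: u)) = a *: D (D u) by rewrite !(linear_opZ _ _ Dl).
rewrite /T0 (DDZ _ (D (D z))) DDD !scalerA.
(* If [s = 0], the left side is 0, and [<D^2 z, D^2 z> = <D^3 z, D z>] vanishes because
   [D^3 = 0]. *)
have [s0|s0] := eqVneq s 0.
  rewrite s0 invr0 !mul0r scale0r; apply/esym/(ip_eq0 ip_norm).
  by rewrite -Ds DDD s0 expr0n /= scale0r ip0l.
by rewrite -!rmorphM /= -invfM -expr2 mulVf ?expf_neq0// scale1r.
Qed.

(** Writing [T0] as [s^-1 (P_x D - P_y D)], its trace is [s^-1 (<D x, x> - <D y, y>) = s^-1 (2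
    s^2)]. *)
Lemma trace_norm_rank_oneB : separable_space H ->
  trace_norm ip (P x - P y) = 2 * gap x y.
Proof.
move=> H_separable; rewrite -/D -/s.
have Db : bounded_operator D.
  exact: bounded_operatorB (rank_one_bounded x) (rank_one_bounded y).
have T0b : bounded_operator T0.
  split; first by move=> a u v; rewrite /T0 !Dl scalerDr !scalerA mulrC.
  have [M M0 DM] := bounded_operator_pos Db.
  exists (s^-1 * M * M) => z; rewrite /T0 normrZ norm_real_complex.
  rewrite ger0_norm ?invr_ge0 ?gap_ge0// !rmorphM /= -!mulrA ler_wpM2l//.
    by rewrite ler0c invr_ge0 gap_ge0.
  by rewrite (le_trans (DM _))// ler_wpM2l// ler0c ltW.
have T0p : positive_operator ip T0.
  by move=> z; rewrite /T0 ipZl Ds mulr_ge0// ?ler0c ?invr_ge0 ?gap_ge0// ip_ge0.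
have T0t : has_trace ip T0 (2 * s)%:C.
  have := has_trace_comb (a := (s^-1)%:C) (b := - (s^-1)%:C)
    (has_trace_rank_one_comp (x := x) ip_norm Db)
    (has_trace_rank_one_comp (x := y) ip_norm Db).
  congr has_trace.
    by apply/funext => z; rewrite /= scaleNr -scalerBr.
  rewrite Dx Dy !ipBl !ipZl !unit_ip//.
  have -> : (s^-1)%:C * (1 - ip x y * ip y x) + - (s^-1)%:C * (ip y x * ip x y - 1)
     = (s^-1)%:C * (1 - ip x y * ip y x) * 2 by ring.
  rewrite -sE -(rmorph_nat (real_complex R) 2) -!rmorphM /=.
  have [->|s0] := eqVneq s 0; first by rewrite mulr0 invr0 mul0r mul0r.
  congr (_%:C); field.
  exact: s0.
have T0D : is_absolute_value ip D T0.
  by split=> // u v; rewrite T0T0 Ds.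
(* The definition selects some absolute value [T] of [D]. It satisfies [T^2 = D^2 = T0^2] and
   commutes with [T0 = s^-1 T^2], hence equals [T0]. *)
rewrite /trace_norm; case: xgetP => [t _ [T [Tb Tp TT] Tt]|/(_ (2 * s)%:C)]; last first.
  by case; exists T0.
have Tl : linear T by case: Tb.
have TTE z : T (T z) = D (D z).
  by apply: (eq_ip ip_norm) => w; rewrite TT -Ds.
have TT0 : T = T0.
  apply: positive_sqrt_unique => //; first by case: T0b.
  - by move=> z; rewrite TTE T0T0.
  - by move=> z; rewrite /T0 linear_opZ// -!TTE.
rewrite TT0 in Tt.
by rewrite (has_trace_unique ip_norm H_separable Tt T0t).
Qed.

End Difference.
End RankOne.

(** * Extreme points of the set of density operators *)

Section PureStates.
Context (R : realType) (H : completeNormedModType R[i]).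
Context (ip : {dot H for Num.conj}).
Context (ip_norm : forall x, ip x x = `|x| ^+ 2).
Context (H_separable : separable_space H).
Implicit Types (x y z u v w : H) (a b c : R[i]) (A B C D T : H -> H) (e : nat -> H).
Notation P := (rank_one ip).

Lemma rank_one_trace_class x : trace_class ip (P x).
Proof.
apply: (positive_trace_class _ _ (has_trace_rank_one ip_norm (x := x))).
- exact: rank_one_bounded.
- exact: rank_one_positive.
Qed.

Lemma real_complex_continuous : continuous (fun r : R => r%:C : R[i]^o).
Proof.
move=> r; apply/(@cvgrPdist_lt _ R[i]^o _ _ (nbhs_filter r)) => e e0.
have e0' : 0 < complex.Re e by rewrite -ltcR -ge0_ReE// ltW.
have /cvgrPdist_lt/(_ _ e0') : (fun t : R => t) @ r --> r by exact: cvg_id.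
apply: filterS => t; rewrite -rmorphB norm_real_complex -ltcR -ge0_ReE//.
exact: ltW.
Qed.

(** The image of the unit ball lies in the compact set of multiples of [x] by scalars whose real and
    imaginary parts are bounded by [||x||]. *)
Lemma rank_one_compact x : compact_operator (P x).
Proof.
split; first exact: rank_one_bounded.
pose I := [set r : R | -nrm x <= r <= nrm x].
pose f (p : R * R) : H := p.1%:C *: x + p.2%:C *: ('i%C *: x).
have If : compact (f @` (I `*` I)).
  apply: continuous_compact.
    apply: continuous_subspaceT => p; apply: cvgD; apply: cvgZr_tmp.
      apply: (@cvg_comp _ _ _ fst (fun r : R => r%:C : R[i]^o) _ (nbhs p.1)).
        exact: cvg_fst.
      exact: real_complex_continuous.
    apply: (@cvg_comp _ _ _ snd (fun r : R => r%:C : R[i]^o) _ (nbhs p.2)).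
      exact: cvg_snd.
    exact: real_complex_continuous.
  have Ic : compact I.
    by have := @segment_compact R (- nrm x) (nrm x);
       congr compact; apply/funext => r; rewrite /I /= in_itv.
  exact: compact_setX.
have If_closed := compact_closed (@norm_hausdorff _ H) If.
apply: (subclosed_compact (@closed_closure _ _) If).
rewrite [X in _ `<=` X](closure_id _).1//; apply: closure_subset.
move=> _ [z /= z1 <-].
exists (complex.Re (ip z x), complex.Im (ip z x)) => /=; last first.
  by rewrite /f /rank_one /= scalerA -scalerDl [_ * 'i%C]mulrC -complexE.
have zx : `|ip z x| <= (nrm x)%:C.
  by rewrite -nrmE (le_trans (ler_norm_ip ip_norm z x))// ler_piMl.
have : (complex.Re (ip z x)) ^+ 2 + complex.Im (ip z x) ^+ 2 <= nrm x ^+ 2.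
  rewrite -lecR add_Re2_Im2 rmorphXn /= lerXn2r// ?nnegrE ?ler0c ?nrm_ge0//.
have sqr_bound (r i n : R) : 0 <= n -> r ^+ 2 + i ^+ 2 <= n ^+ 2 -> - n <= r <= n.
  move=> n0 h; rewrite -ler_norml -(@ler_pXn2r _ 2)// ?nnegrE//.
  by rewrite real_normK ?num_real// (le_trans _ h)// lerDl sqr_ge0.
move=> h; split => /=; first exact: (sqr_bound _ _ _ (nrm_ge0 x) h).
by rewrite addrC in h; exact: (sqr_bound _ _ _ (nrm_ge0 x) h).
Qed.

Lemma Bs_rank_one x : Bs ip (P x).
Proof. by split; [exact: rank_one_bounded|exact: rank_one_self_adjoint]. Qed.

Lemma Ts_rank_one x : Ts ip (P x).
Proof. by split; [exact: rank_one_trace_class|exact: rank_one_self_adjoint]. Qed.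

Lemma Cs_rank_one x : Cs ip (P x).
Proof. by split; [exact: rank_one_compact|exact: rank_one_self_adjoint]. Qed.

(** The diagonal terms are nonnegative, so every partial sum past [n] dominates the term of index
    [n]. *)
Lemma positive_trace_term A (t : R) e n : positive_operator ip A ->
  has_trace ip A t%:C -> orthonormal_basis ip e ->
  ip (A (e n)) (e n) <= t%:C.
Proof.
move=> Ap At eB.
have Ret : (fun m => complex.Re (series (fun k => ip (A (e k)) (e k) : R[i]^o) m))
    @ \oo --> t.
  apply: (@cvg_comp _ _ _ _ (@complex.Re R : R[i]^o -> R) _ _ _ (At e eB)).
  exact: (@Re_continuous R t%:C).
rewrite (ge0_ReE (Ap (e n))) lecR.
apply: (@cvgr_to_ge _ _ _ _ _ _ _ Ret).
near=> m; have nm : (n < m)%N by near: m; exact: nbhs_infty_gt.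
rewrite /series /= big_mkord (bigD1 (Ordinal nm))//= raddfD lerDl /=.
apply: Re_ge0; apply: sumr_ge0 => i _; exact: Ap.
Unshelve. all: by end_near. Qed.

Lemma positive_trace_ge0 A (t : R) : positive_operator ip A ->
  has_trace ip A t%:C -> 0 <= t.
Proof.
move=> Ap At; have [e eB] := exists_orthonormal_basis ip_norm H_separable.
rewrite -ler0c; apply: le_trans (positive_trace_term 0 Ap At eB); exact: Ap.
Qed.

(** All diagonal terms vanish, so [A] kills each basis vector by [positive_kernel], and then every
    limit of Fourier sums. *)
Lemma positive_trace0 A : bounded_operator A -> positive_operator ip A ->
  has_trace ip A 0 -> A = fun=> 0.
Proof.
move=> /[dup] Ab [Al _] Ap At; have [e eB] := exists_orthonormal_basis ip_norm H_separable.
have Ae n : A (e n) = 0.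
  apply: (positive_kernel ip_norm Al Ap); apply/eqP; rewrite eq_le Ap andbT.
  exact: (@positive_trace_term A 0).
apply/funext => x.
have Ax : (fun n => A (fourier_sum ip e n x)) @ \oo --> A x.
  have h := fourier_sum_cvg ip_norm eB (x := x).
  exact: (cvg_bounded_operator Ab h).
have A0 : (fun n => A (fourier_sum ip e n x)) @ \oo --> (0 : H).
  rewrite (_ : (fun _ => _) = fun=> 0); first exact: cvg_cst.
  apply/funext => n /=; rewrite linear_op_fourier_sum// big1// => i _.
  by rewrite Ae scaler0.
by apply: (@cvg_unique H (@norm_hausdorff _ H) _ _ _ _ Ax A0).
Qed.

(** The default value of [trace] is 0, so the value 1 can only come from an actual trace. *)
Lemma density_has_trace A : density_operators ip A -> has_trace ip A 1.
Proof.
move=> [_ _]; rewrite /trace; case: xgetP => [t _ At <-//|_ /eqP].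
by rewrite eq_sym oner_eq0.
Qed.

Lemma density_rank_one x : `|x| = 1 -> density_operators ip (P x).
Proof.
move=> x1; split; [exact: rank_one_trace_class|exact: rank_one_positive|].
have := has_trace_rank_one ip_norm (x := x); rewrite unit_ip//.
exact: traceE.
Qed.

Lemma has_traceZ a A t : has_trace ip A t -> has_trace ip (fun z => a *: A z) (a * t).
Proof.
move=> At; have := has_trace_comb (a := a) (b := 0) At At.
rewrite mul0r addr0; congr has_trace.
by apply/funext => z; rewrite scale0r addr0.
Qed.

(** For [y] orthogonal to [x], [<P_x y, y> = 0] forces [<B y, y> = 0], hence [B y = 0]. By
    self-adjointness [B x] is then a multiple of [x], so [B] is a multiple of [P_x], and the trace
    fixes the factor as 1. *)
Lemma convex_rank_one_eq x B C (t : R) : `|x| = 1 -> density_operators ip B ->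
  density_operators ip C -> 0 < t -> t < 1 ->
  P x = t%:C *: B + (1 - t)%:C *: C -> B = P x.
Proof.
move=> x1 Bd [_ Cp _] t0 t1 PE.
have [[[Bl _] _] Bp _] := Bd.
have Bs := positive_self_adjoint Bl Bp.
have B0 y : ip y x = 0 -> B y = 0.
  move=> yx; apply: (positive_kernel ip_norm Bl Bp).
  have : ip (P x y) y = 0 by rewrite /rank_one yx scale0r ip0l.
  rewrite PE [X in ip X _](_ : _ = t%:C *: B y + (1 - t)%:C *: C y)//.
  rewrite ipDl !ipZl => /eqP; rewrite paddr_eq0.
  - rewrite mulf_eq0 => /andP[/orP[/eqP[t_eq0]|/eqP//] _].
    by rewrite t_eq0 ltxx in t0.
  - by rewrite mulr_ge0 ?Bp// ler0c ltW.
  - by rewrite mulr_ge0 ?Cp// ler0c subr_ge0 ltW.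
have BE y : B y = ip y x *: B x.
  apply/eqP; rewrite -subr_eq0 -(linear_opZ _ _ Bl) -(linear_opB _ _ Bl).
  by rewrite B0// ipBl ipZl unit_ip// mulr1 subrr.
have Bx : B x = ip (B x) x *: x.
  apply/subr0_eq/(ip_eq0 ip_norm); set w := _ - _.
  have wx : ip w x = 0 by rewrite ipBl ipZl unit_ip// mulr1 subrr.
  rewrite {1}/w ipBl ipZl Bs B0// ip0r (ipC ip x) wx.
  by rewrite conjC0 mulr0 subrr.
have BP : B = fun z => ip (B x) x *: P x z.
  by apply/funext => z; rewrite BE Bx scalerA mulrC -scalerA ipZl unit_ip// mulr1.
have := density_has_trace Bd.
have := has_traceZ (a := ip (B x) x) (has_trace_rank_one ip_norm (x := x)).
rewrite -BP unit_ip// mulr1 => h1 h2.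
rewrite BP (has_trace_unique ip_norm H_separable h1 h2).
by apply/funext => z; rewrite scale1r.
Qed.

Lemma pure_rank_one x : `|x| = 1 -> pure_states ip (P x).
Proof.
move=> x1; split; first exact: density_rank_one.
move=> B C t Bd Cd t0 t1 PE; split; first exact: convex_rank_one_eq PE.
apply: (@convex_rank_one_eq x C B (1 - t)) => //; rewrite ?subr_gt0//.
  by rewrite gtrBl.
by rewrite PE addrC opprB addrCA subrr addr0.
Qed.

(* For [u = A v], the operator [|u><u| / <A v, v>] is dominated by [A]
   (Cauchy-Schwarz for the form of [A]), so that it splits off [A]: no spectral
   decomposition is needed to find a rank one component. *)
Lemma pure_stateP A : pure_states ip A -> exists2 x, `|x| = 1 & A = P x.
Proof.
move=> [Ad Aext]; have At := density_has_trace Ad.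
have [[Ab _] Ap _] := Ad; have [Al _] := Ab.
have As := positive_self_adjoint Al Ap.
have [v v0] : exists v, ip (A v) v != 0.
  apply: contrapT => /forallNP A0.
  (* The zero operator is written as [P 0], whose trace is known to be 0. *)
  have A00 : A = P 0.
    apply/funext => z; rewrite /rank_one scaler0.
    apply: (positive_kernel ip_norm Al Ap); apply/eqP/negP/negP.
    by have /negP := A0 z; rewrite negbK.
  rewrite A00 in At.
  have := has_trace_unique ip_norm H_separable At (has_trace_rank_one ip_norm (x := 0)).
  by rewrite ip0l => /eqP; rewrite oner_eq0.
have [q qE] : exists q : R, ip (A v) v = q%:C.
  by exists (complex.Re (ip (A v) v)); exact: ge0_ReE.
have q0 : 0 < q by rewrite -ltcR -qE lt_def v0 Ap.
pose u := A v.
have u0 : u != 0.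
  by apply: contra_neq v0; rewrite -/u => ->; rewrite ip0l.
have nu0 : 0 < nrm u by rewrite -ltcR -nrmE normr_gt0.
pose x := (nrm u)^-1%:C *: u.
have x1 : `|x| = 1.
  rewrite normrZ norm_real_complex ger0_norm ?invr_ge0 ?nrm_ge0// nrmE.
  by rewrite -rmorphM /= mulVf ?gt_eqF.
(* Chosen so that [b P_x] is [|u><u| / <A v, v>], the part split off from [A]; [C] is the
   remainder. *)
pose b := nrm u ^+ 2 / q.
have b0 : 0 < b by rewrite divr_gt0// exprn_gt0.
pose C z := 1 *: A z + - b%:C *: P x z.
have PxE z : b%:C *: P x z = q^-1%:C *: P u z.
  rewrite /rank_one /x ipZr !scalerA; congr (_ *: _).
  rewrite (conj_ge0E _) ?ler0c ?invr_ge0 ?nrm_ge0//.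
  transitivity ((b * ((nrm u)^-1 * (nrm u)^-1))%:C * ip z u).
    by rewrite !rmorphM /=; ring.
  congr (_%:C * _); rewrite /b; field; by rewrite !gt_eqF.
have Cb : bounded_operator C by apply: bounded_operator_comb => //; exact: rank_one_bounded.
have Cp : positive_operator ip C.
  move=> z; rewrite /C scale1r scaleNr PxE ipBl ipZl /rank_one ipZl (ipC ip u) -normCK.
  rewrite subr_ge0 fmorphV /= mulrC ler_pdivrMr ?ltcR// -qE.
  by rewrite /u -As; exact: positive_CauchySchwarz.
have Ct : has_trace ip C (1 - b)%:C.
  have -> : (1 - b)%:C = 1 * 1 + - b%:C * ip x x.
    by rewrite (unit_ip ip_norm x1) !mulr1 rmorphB.
  exact: has_trace_comb At (has_trace_rank_one ip_norm (x := x)).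
have b1 : 0 <= 1 - b by exact: positive_trace_ge0 Cp Ct.
exists x => //.
have CE z : A z = b%:C *: P x z + C z by rewrite /C scale1r scaleNr addrC subrK.
(* If [b = 1], the remainder has trace 0 and vanishes. Otherwise [A] is a proper convex combination
   of [P_x] and the rescaled remainder, and extremality applies. *)
move: b1; rewrite subr_ge0 le_eqVlt => /predU1P[b1|b1].
  have t0 : (1 - b)%:C = 0 by rewrite b1 subrr.
  rewrite t0 in Ct; have C0 := positive_trace0 Cb Cp Ct.
  by apply/funext => z; rewrite CE C0 addr0 b1 scale1r.
pose C' z := (1 - b)^-1%:C *: C z.
have b1' : 0 < 1 - b by rewrite subr_gt0.
have C't : has_trace ip C' 1.
  have -> : 1 = (1 - b)^-1%:C * (1 - b)%:C by rewrite -rmorphM /= mulVf ?gt_eqF.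
  exact: has_traceZ.
have C'p : positive_operator ip C'.
  by move=> z; rewrite /C' ipZl mulr_ge0 ?Cp// ler0c invr_ge0 ltW.
have C'b : bounded_operator C'.
  have := bounded_operator_comb (1 - b)^-1%:C 0 Cb Cb; congr bounded_operator.
  by apply/funext => z; rewrite scale0r addr0.
have C'd : density_operators ip C'.
  split => //; first exact: positive_trace_class C't.
  exact: traceE.
have [] // := Aext (P x) C' b (density_rank_one x1) C'd b0 b1.
apply/funext => z; rewrite CE; congr (_ + _).
rewrite /C' -[RHS]/((1 - b)%:C *: ((1 - b)^-1%:C *: C z)) scalerA -rmorphM /=.
by rewrite mulfV ?gt_eqF// scale1r.
Qed.

End PureStates.

(** * Topologies on the pure states *)

Section Neighbourhoods.
Context (R : realType) (H : completeNormedModType R[i]).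
Implicit Types (x y : H).

(** Radii of balls in [H] live in [R[i]]; being positive they are real, which permits working over
    [R]. *)
Lemma nbhs_nrmP x (Q : set H) :
  nbhs x Q <-> exists2 e : R, 0 < e & forall y, nrm (x - y) < e -> Q y.
Proof.
split.
  move=> /nbhs_ballP[e /= e0 xeQ]; exists (complex.Re e).
    by rewrite -ltcR -ge0_ReE// ltW.
  move=> y; rewrite -ltcR -nrmE -ge0_ReE ?ltW// => xy; apply: xeQ.
  by rewrite -ball_normE.
move=> [e e0 xQ]; apply/nbhs_ballP; exists e%:C; first by rewrite /= ltcR.
by move=> y; rewrite -ball_normE /= nrmE ltcR => /xQ.
Qed.

Lemma near_within_nrmP (A : set H) x (Q : set H) :
  (\forall y \near within A (nbhs x), Q y) <->
  exists2 e : R, 0 < e & forall y, A y -> nrm (x - y) < e -> Q y.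
Proof.
rewrite near_withinE; split.
  by move=> /nbhs_nrmP[e e0 eQ]; exists e => // y Ay /eQ; exact.
by move=> [e e0 eQ]; apply/nbhs_nrmP; exists e => // y /[swap] /eQ; exact.
Qed.

Lemma open_subtypeP (A : set H) (Q : set A) :
  open Q <-> forall x : A, Q x ->
    exists2 e : R, 0 < e & forall y : A, nrm (set_val x - set_val y) < e -> Q y.
Proof.
split.
  move=> [W Wo <-] x /= Wx.
  have /nbhs_nrmP[e e0 eW] : nbhs (set_val x) W by exact: open_nbhs_nbhs.
  by exists e => // y /eW.
move=> Qe; rewrite openE => x /Qe[e e0 eQ]; rewrite /interior.
have xe : nbhs (set_val x) [set y | nrm (set_val x - y) < e].
  by apply/nbhs_nrmP; exists e.
have h : nbhs (x : initial_topology (set_val : A -> H))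
    (set_val @^-1` [set y | nrm (set_val x - y) < e]).
  exact: (@initial_continuous A H set_val x).
by apply: (@filterS _ _ (nbhs_filter _) _ _ _ h) => y; exact: eQ.
Qed.

End Neighbourhoods.

(** * Open sets and convergence in initial topologies *)

Section InitialTopologies.
Context (T : choiceType) (I : Type) (V : topologicalType) (f : I -> T -> V).

Lemma coarsest_topology_preimage i (O : set V) :
  open O -> coarsest_topology f (f i @^-1` O).
Proof.
move=> Oo; rewrite /coarsest_topology openE => t Ot; rewrite /interior.
pose Tc j := Topological.on (initial_topology (f j)).
have := (@cvg_sup T I Tc (nbhs (t : sup_topology Tc)) t _).1.
move=> /(_ _ (fun A h => h) i); apply.
by rewrite nbhsE; exists (f i @^-1` O) => //; split => //; exists O.
Qed.

(** Convergence in a supremum of initial topologies amounts to convergence of every [f i]. *)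
Lemma coarsest_topology_near (S : Type) (F : set_system S) (r : S -> T) t W :
  Filter F -> (forall i, f i \o r @ F --> f i t) ->
  coarsest_topology f W -> W t -> \forall s \near F, W (r s).
Proof.
move=> FF fr Wo Wt.
pose Tc j := Topological.on (initial_topology (f j)).
have : r @ F --> (t : sup_topology Tc).
  apply/cvg_sup => i A; rewrite nbhsE => -[_ [[Z Zo <-] Zt] ZA].
  by apply: filterS ZA _; apply: (fr i); exact: open_nbhs_nbhs.
by apply; exact: open_nbhs_nbhs.
Qed.

End InitialTopologies.

(** * Comparison of each topology with that of the operator norm *)

Section PureStateTopologies.
Context (R : realType) (H : completeNormedModType R[i]).
Context (ip : {dot H for Num.conj}).
Context (ip_norm : forall x, ip x x = `|x| ^+ 2).
Context (H_separable : separable_space H).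
Implicit Types (x y z u v w : H) (a b c : R[i]) (A B C D T : H -> H) (e : nat -> H).
Notation P := (rank_one ip).

Lemma nrmB_unit x y : `|x| = 1 -> `|y| = 1 ->
  nrm (x - y) ^+ 2 = 2 - 2 * complex.Re (ip x y).
Proof.
move=> x1 y1; apply: complexI; rewrite -(ip_nrm ip_norm) ipBl !ipBr !unit_ip//.
rewrite (ipC ip y x) rmorphB rmorphM /= rmorph_nat -addcJ.
by rewrite -[Num.conj _]/((ip x y)^*); ring.
Qed.

(** With [r] the real part of [<x, y>], the overlap is at least [r^2], and
    [1 - r^2 = (2 - 2 r) - (1 - r)^2]. *)
Lemma gap_le_nrm x y : `|x| = 1 -> `|y| = 1 -> gap ip x y <= nrm (x - y).
Proof.
move=> x1 y1; rewrite -(@ler_pXn2r _ 2)// ?nnegrE ?gap_ge0 ?nrm_ge0//.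
rewrite gap_sqr// nrmB_unit//.
have : (complex.Re (ip x y)) ^+ 2 <= overlap ip x y.
  by rewrite -lecR -overlapE (ipC ip y) -normCK -add_Re2_Im2 lecR lerDl sqr_ge0.
move: (overlap _ _ _) (complex.Re (ip x y)) => o r ro.
have : 0 <= (1 - r) ^+ 2 by exact: sqr_ge0.
by rewrite sqrrB; lra.
Qed.

(** Taking for [c] the phase of [<x, y>] makes [<x, c y> = k := |<x, y>|], and
    [2 - 2 k <= 2 - 2 k^2] since [k <= 1]. In the orthogonal case [c = 1] will do. *)
Lemma phase_align x y : `|x| = 1 -> `|y| = 1 ->
  exists2 c, `|c| = 1 & nrm (x - c *: y) ^+ 2 <= 2 * gap ip x y ^+ 2.
Proof.
move=> x1 y1; rewrite gap_sqr//.
have [xy0|xy0] := eqVneq (ip x y) 0.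
  exists 1; rewrite ?normr1// scale1r nrmB_unit// /overlap xy0 mul0r /=.
  by rewrite mulr0 !subr0 mulr1.
have cE : `|ip x y / `|ip x y| | = 1.
  by rewrite normrM normfV normr_id mulfV// normr_eq0.
exists (ip x y / `|ip x y|) => //.
have cy1 : `|(ip x y / `|ip x y|) *: y| = 1 by rewrite normrZ cE mul1r.
rewrite (nrmB_unit x1 cy1) ipZr.
have [k kE] : exists k : R, `|ip x y| = k%:C.
  by exists (complex.Re `|ip x y|); exact: ge0_ReE.
have k0 : 0 <= k by rewrite -ler0c -kE.
have k1 : k <= 1.
  by rewrite -lecR -kE (le_trans (ler_norm_ip ip_norm _ _))// x1 y1 mulr1.
have -> : Num.conj (ip x y / `|ip x y|) * ip x y = k%:C.
  rewrite rmorphM fmorphV /= (conj_ge0E (normr_ge0 _)) mulrAC mulrC [X in _ * X]mulrC.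
  by rewrite -normCK expr2 mulrA mulVf ?mul1r// normr_eq0.
have -> : overlap ip x y = k ^+ 2.
  by apply: complexI; rewrite -overlapE (ipC ip y) -normCK kE rmorphXn.
have kk : k ^+ 2 <= k by rewrite expr2 ler_piMl.
by rewrite /=; lra.
Qed.

(** The map [x |-> P_x] is total on [H], but only its values on unit vectors are specified. *)
Context (pr : H -> pure_states ip).
Context (prE : forall x, `|x| = 1 -> set_val (pr x) = P x).

Lemma pr_phase c x : `|c| = 1 -> `|x| = 1 -> pr (c *: x) = pr x.
Proof.
move=> c1 x1; apply: val_inj; rewrite -!set_valE !prE ?rank_one_phase//.
by rewrite normrZ c1 x1 mulr1.
Qed.

Lemma pr_surj (p : pure_states ip) : exists2 x, `|x| = 1 & p = pr x.
Proof.
have [x x1 pE] := pure_stateP ip_norm H_separable (set_valP p).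
by exists x => //; apply: val_inj; rewrite -!set_valE prE.
Qed.

Definition sphere_open (U : set (pure_states ip)) :=
  forall x, `|x| = 1 -> U (pr x) ->
  exists2 e : R, 0 < e & forall y, `|y| = 1 -> nrm (x - y) < e -> U (pr y).

Lemma T_n_dist x y : `|x| = 1 -> `|y| = 1 ->
  op_norm (set_val (pr x) - set_val (pr y)) = gap ip x y.
Proof. by move=> x1 y1; rewrite !prE// op_norm_rank_oneB. Qed.

Lemma T_nP U : T_n ip U <-> sphere_open U.
Proof.
split=> [Un x x1 /Un[e e0 eU]|Us p Up].
  exists e => // y y1 xy; apply: eU; rewrite T_n_dist//.
  exact: le_lt_trans (gap_le_nrm x1 y1) xy.
have [x x1 pE] := pr_surj p; rewrite pE in Up *.
(* Aligning phases costs a factor at most the square root of 2, and [2 (e / 2)^2 < e^2]. *)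
have [e e0 eU] := Us x x1 Up; exists (e / 2); first by rewrite divr_gt0.
move=> q; have [y y1 ->] := pr_surj q; rewrite T_n_dist// => xy.
have [c c1 xcy] := phase_align x1 y1.
rewrite -(pr_phase c1 y1); apply: eU; first by rewrite normrZ c1 y1 mulr1.
rewrite -(@ltr_pXn2r _ 2)// ?nnegrE ?nrm_ge0// ?ltW//.
apply: le_lt_trans xcy _.
have : gap ip x y ^+ 2 < (e / 2) ^+ 2.
  by rewrite ltr_pXn2r// ?nnegrE ?gap_ge0// ltW// divr_gt0.
have : 0 < e ^+ 2 by rewrite exprn_gt0.
by rewrite expr_div_n; lra.
Qed.

Lemma T_trE : T_tr ip = T_n ip.
Proof.
have dE (p q : pure_states ip) :
    trace_norm ip (set_val p - set_val q) = 2 * op_norm (set_val p - set_val q).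
  have [[x x1 ->] [y y1 ->]] := (pr_surj p, pr_surj q).
  by rewrite T_n_dist// !prE// trace_norm_rank_oneB.
apply/seteqP; split=> U Ut p /Ut[e e0 eU].
  exists (e / 2); first by rewrite divr_gt0.
  by move=> q pq; apply: eU; rewrite dE mulrC -ltr_pdivlMr.
exists (2 * e); first by rewrite mulr_gt0.
by move=> q; rewrite dE ltr_pM2l// => /eU.
Qed.

(** The common criterion for the weak topologies. Continuity of each [f i] along the sphere makes
    the restricted topology coarser than [T_n]; recovering the overlap with [x] from some [f i]
    makes it finer. *)
Lemma restrict_coarsestE (X : set (H -> H)) (I : Type) (V : topologicalType)
    (f : I -> X -> V) (r : H -> X) :
  (forall x, `|x| = 1 -> set_val (r x) = P x) ->
  (forall i x, `|x| = 1 ->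
    f i \o r @ within (unit_sphere H) (nbhs x) --> f i (r x)) ->
  (forall x, `|x| = 1 -> exists i (phi : V -> R), continuous phi /\
    forall y, `|y| = 1 -> phi (f i (r y)) = overlap ip x y) ->
  restrict_topology X (coarsest_topology f) (pure_states ip) = T_n ip.
Proof.
move=> rE fr fphi; apply/seteqP; split=> U.
  move=> [W Wo ->]; apply/T_nP => x x1 [v Wv vx].
  have {vx} vE : v = r x.
    by apply: val_inj; rewrite -!set_valE rE// vx prE.
  rewrite {}vE in Wv.
  have : \forall y \near within (unit_sphere H) (nbhs x), W (r y).
    by apply: (coarsest_topology_near _ _ Wo Wv) => i; exact: fr.
  move=> /near_within_nrmP[e e0 eW]; exists e => // y y1 xy.
  by exists (r y); [exact: eW|rewrite rE// prE].
move=> Un.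
(* The largest open set of [X] whose pure states all lie in [U]; it remains to see that it reaches
   every point of [U]. *)
exists (\bigcup_(O in [set O | coarsest_topology f O /\
    forall y, `|y| = 1 -> O (r y) -> U (pr y)]) O).
  by apply: bigcup_open => O [].
apply/seteqP; split=> p /=.
  have [x x1 ->] := pr_surj p => /Un[e e0 eU].
  have [i [phi [phic phiE]]] := fphi x x1.
  exists (r x); last by rewrite rE// prE.
  (* An overlap above [1 - e^2] means a gap below [e]. *)
  exists (f i @^-1` (phi @^-1` [set t | 1 - e ^+ 2 < t])).
    split.
      apply: coarsest_topology_preimage.
      by apply: open_comp => [t _|]; [exact: phic|exact: open_gt].
    move=> y y1; rewrite /= phiE// => xy; apply: eU; rewrite T_n_dist//.
    rewrite -(@ltr_pXn2r _ 2)// ?nnegrE ?gap_ge0// ?ltW//.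
    by rewrite gap_sqr// ltrBlDr -ltrBlDl.
  by rewrite /= phiE// /overlap unit_ip// mulr1 /= ltrBlDr ltrDl exprn_gt0.
move=> [v [W [_ WU] Wv] vp]; have [x x1 pE] := pr_surj p.
rewrite pE; apply: WU => //; rewrite -(_ : v = r x)//.
by apply: val_inj; rewrite -!set_valE rE// vp pE prE.
Qed.

Lemma trace_pairing_rank_one x B : bounded_operator B ->
  trace_pairing ip (P x) B = complex.Re (ip (B x) x).
Proof.
move=> Bb; rewrite /trace_pairing.
by rewrite (traceE ip_norm H_separable (has_trace_rank_one_comp ip_norm Bb (x := x))).
Qed.

Lemma expectation_cvg x B (A : set H) : bounded_operator B ->
  (fun y => complex.Re (ip (B y) y)) @ within A (nbhs x) --> complex.Re (ip (B x) x).
Proof.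
move=> Bb.
have xx : (fun y => y) @ within A (nbhs x) --> x by exact: cvg_within.
have h : (fun y => ip (B y) y : R[i]^o) @ within A (nbhs x) --> (ip (B x) x : R[i]^o).
  by apply: cvg_ip => //; exact: (cvg_bounded_operator Bb xx).
apply: (@cvg_comp _ _ _ _ (@complex.Re R : R[i]^o -> R) _ _ _ h).
exact: (@Re_continuous R (ip (B x) x)).
Qed.

(** The pairing of [P_y] with [B] is the expectation [<B y, y>], continuous in [y]; for [B = P_x],
    available through [s], it is the overlap. *)
Lemma restrict_sigmaE (X Y : set (H -> H)) (r : H -> X) (s : H -> Y) :
  (forall x, `|x| = 1 -> set_val (r x) = P x) ->
  (forall x, `|x| = 1 -> set_val (s x) = P x) ->
  (forall B, Y B -> bounded_operator B) ->
  restrict_topology X (@sigma R H ip X Y) (pure_states ip) = T_n ip.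
Proof.
move=> rE sE Yb; apply: (restrict_coarsestE (r := r)) => //.
  move=> B x x1; have Bb := Yb _ (set_valP B).
  rewrite rE// trace_pairing_rank_one//.
  have h := @expectation_cvg x (set_val B) (unit_sphere H) Bb.
  apply: cvg_trans h; apply: near_eq_cvg.
  (* The two functions agree on the whole sphere, so the radius is arbitrary. *)
  apply/near_within_nrmP; exists 1 => // y y1 _.
  by rewrite /= rE// trace_pairing_rank_one.
move=> x x1; exists (s x), id; split; first by move=> t; exact: cvg_id.
move=> y y1; rewrite rE// sE// trace_pairing_rank_one; last exact: rank_one_bounded.
by rewrite /rank_one ipZl -[LHS]/(overlap ip y x) overlapC.
Qed.

(** Lets [T_0] be treated as a restricted weak topology, with the pure states on both sides of the
    pairing. *)
Lemma restrict_topology_id (X : set (H -> H)) (tau : set (set X)) :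
  restrict_topology X tau X = tau.
Proof.
have idE (V : set X) : [set y : X | (set_val @` V) (set_val y)] = V.
  apply/seteqP; split=> y /=; last by exists y.
  by move=> [v Vv /val_inj <-].
apply/seteqP; split=> [U [V tV ->]|U tU]; first by rewrite idE.
by exists U; rewrite ?idE.
Qed.

Lemma T_0E : T_0 ip = T_n ip.
Proof.
rewrite -[LHS]restrict_topology_id.
apply: (restrict_sigmaE (r := pr) (s := pr)) => //.
by move=> B [[[]]].
Qed.

Let rC x : Cs ip := exist _ (P x) (mem_set (Cs_rank_one ip_norm x)).
Let rT x : Ts ip := exist _ (P x) (mem_set (Ts_rank_one ip_norm x)).
Let rB x : Bs ip := exist _ (P x) (mem_set (Bs_rank_one ip_norm x)).
Let rb x : @Bounded R H := exist _ (P x) (mem_set (rank_one_bounded ip_norm x)).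

Lemma T_1E : T_1 ip = T_n ip.
Proof.
by apply: (restrict_sigmaE (r := rC) (s := rT)) => // B [[]].
Qed.

Lemma T_2E : T_2 ip = T_n ip.
Proof.
by apply: (restrict_sigmaE (r := rT) (s := rC)) => // B [[]].
Qed.

Lemma T_3E : T_3 ip = T_n ip.
Proof.
by apply: (restrict_sigmaE (r := rT) (s := rB)) => // B [].
Qed.

Lemma T_4E : T_4 ip = T_n ip.
Proof.
by apply: (restrict_sigmaE (r := rB) (s := rT)) => // B [[]].
Qed.

Lemma rank_one_cvg u x (A : set H) :
  (fun y => P y u) @ within A (nbhs x) --> P x u.
Proof.
have xx : (fun y => y) @ within A (nbhs x) --> x by exact: cvg_within.
by apply: cvgZ => //; apply: cvg_ip => //; exact: cvg_cst.
Qed.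

Lemma T_wE : T_w ip = T_n ip.
Proof.
apply: (restrict_coarsestE (r := rb)) => //.
  move=> [u v] x x1; apply: cvg_ip => //; [exact: rank_one_cvg|exact: cvg_cst].
move=> x x1; exists (x, x), (@complex.Re R); split; first exact: Re_continuous.
by move=> y y1; rewrite /= /rank_one ipZl.
Qed.

Lemma T_sE : T_s ip = T_n ip.
Proof.
apply: (restrict_coarsestE (r := rb)) => //.
  by move=> u x x1; exact: rank_one_cvg.
move=> x x1; exists x, (fun v => complex.Re (ip v x)); split; last first.
  by move=> y y1; rewrite /= /rank_one ipZl.
move=> v.
have h : (fun w => ip w x : R[i]^o) @ v --> (ip v x : R[i]^o).
  by apply: cvg_ip => //; exact: cvg_cst.
apply: (@cvg_comp _ _ _ _ (@complex.Re R : R[i]^o -> R) _ _ _ h).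
exact: (@Re_continuous R (ip v x)).
Qed.

(** The functional whose value at [P_y] is the overlap with [x], as [T_5] requires. *)
Lemma Bs_dual_expectation x : `|x| = 1 ->
  @Bs_dual R H ip (fun A : Bs ip => complex.Re (ip (set_val A x) x)).
Proof.
move=> x1; split.
  move=> a A B C ->; rewrite ipDl ipZl raddfD /=; congr (_ + _).
  by case: (ip _ _) => p q /=; rewrite mul0r subr0.
exists 1 => A; rewrite mul1r -lecR; apply: le_trans (normr_Re_le _) _.
apply: le_trans (ler_norm_ip ip_norm _ _) _; rewrite x1 mulr1 nrmE lecR.
by apply: nrm_le_op_norm; rewrite ?x1//; have [] := set_valP A.
Qed.

Lemma Bs_rank_oneB x y : Bs ip (P x - P y).
Proof.
split; first by apply: bounded_operatorB; exact: rank_one_bounded.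
by move=> u v; rewrite !fctE ipBl ipBr !rank_one_self_adjoint.
Qed.

(** A bounded functional [F] is continuous along the sphere because
    [|F (P_x - P_y)| <= M s <= M ||x - y||] for a positive bound [M]. *)
Lemma T_5E : T_5 ip = T_n ip.
Proof.
apply: (restrict_coarsestE (r := rB)) => //; last first.
  move=> x x1.
  exists (exist (fun F => F \in @Bs_dual R H ip) _ (mem_set (Bs_dual_expectation x1))).
  exists id.
  split; first by move=> t; exact: cvg_id.
  by move=> y y1; rewrite -[LHS]/(complex.Re (ip (P y x) x)) /rank_one ipZl.
move=> F x x1; have [F_linear [M FM]] := set_valP F.
apply/cvgrPdist_lt => e e0; apply/near_within_nrmP.
(* The bound [M] of [F] may be nonpositive, and the radius divides by it. *)
have M1 : 0 < Num.max M 1 by rewrite lt_max ltr01 orbT.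
exists (e / Num.max M 1); first by rewrite divr_gt0.
move=> y y1 xy.
pose D : Bs ip := exist _ (P x - P y) (mem_set (Bs_rank_oneB x y)).
have -> : set_val F (rB x) = 1 * set_val F D + set_val F (rB y).
  by apply: F_linear; rewrite scale1r subrK.
rewrite /= mul1r addrK; apply: le_lt_trans (FM D) _.
rewrite op_norm_rank_oneB//.
apply: (@le_lt_trans _ _ (Num.max M 1 * nrm (x - y))).
  apply: le_trans (_ : Num.max M 1 * gap ip x y <= _).
    by rewrite ler_wpM2r ?gap_ge0// le_max lexx.
  by rewrite ler_wpM2l ?gap_le_nrm// ltW.
by rewrite mulrC -ltr_pdivlMr.
Qed.

(** Openness in the quotient is openness of the preimage in the sphere, which is [sphere_open]. *)
Lemma T_nuE (g : unit_rays H -> pure_states ip) :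
  (forall x : unit_sphere H, g (unit_ray x) = pr (set_val x)) ->
  transport_topology g (T_nu H) = T_n ip.
Proof.
move=> gE; apply/seteqP; split=> U.
  move=> /open_subtypeP Uo; apply/T_nP => x x1 Ux.
  pose sx : unit_sphere H := exist _ x (mem_set (x1 : unit_sphere H x)).
  have [|e e0 eU] := Uo sx; first by rewrite /= gE.
  exists e => // y y1 xy.
  pose sy : unit_sphere H := exist _ y (mem_set (y1 : unit_sphere H y)).
  by have := eU sy xy; rewrite /= gE.
move=> /T_nP Us; apply/open_subtypeP => x; rewrite /= gE => Ux.
have [e e0 eU] := Us _ (set_valP x) Ux.
by exists e => // y xy; rewrite gE; apply: eU => //; exact: set_valP y.
Qed.

Lemma normalize_cvg x : x != 0 ->
  (fun y => (nrm y)^-1%:C *: y) @ x --> (nrm x)^-1%:C *: x.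
Proof.
move=> x0; have nx0 : nrm x != 0.
  by apply: contra_neq x0 => nx0; apply/eqP; rewrite -normr_eq0 nrmE nx0.
have nx : (fun y => (nrm y)^-1) @ x --> (nrm x)^-1.
  by apply: cvgV => //; apply: cvg_nrm; exact: cvg_id.
apply: cvgZ; last exact: cvg_id.
apply: (@cvg_comp _ _ _ _ (fun r : R => r%:C : R[i]^o) _ _ _ nx).
exact: real_complex_continuous.
Qed.

(** One inclusion restricts from nonzero vectors to the sphere, where normalization is the identity;
    the other uses the continuity of normalization. *)
Lemma T_muE (g : projective_space H -> pure_states ip) :
  (forall x : nonzero_vectors H, g (ray x) = pr (set_val (normalize x))) ->
  transport_topology g (T_mu H) = T_n ip.
Proof.
move=> gE; apply/seteqP; split=> U.
  move=> /open_subtypeP Uo; apply/T_nP => x x1 Ux.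
  have unitE (s : nonzero_vectors H) : `|set_val s| = 1 -> g (ray s) = pr (set_val s).
    by move=> s1; rewrite gE set_valE /= s1 invr1 scale1r.
  have nz y : `|y| = 1 -> y \in nonzero_vectors H.
    by move=> y1; apply/mem_set; rewrite /nonzero_vectors /= -normr_eq0 y1 oner_eq0.
  pose sx : nonzero_vectors H := exist _ x (nz x x1).
  have [|e e0 eU] := Uo sx; first by rewrite /= unitE.
  exists e => // y y1 xy.
  pose sy : nonzero_vectors H := exist _ y (nz y y1).
  by have := eU sy xy; rewrite /= unitE.
move=> /T_nP Us; apply/open_subtypeP => x; rewrite /= gE => Ux.
have nE (s : nonzero_vectors H) : set_val (normalize s) = (nrm (set_val s))^-1%:C *: set_val s.
  by rewrite set_valE /= fmorphV /= -nrmE.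
have [e e0 eU] := Us _ (set_valP (normalize x)) Ux.
have ne : nbhs ((nrm (set_val x))^-1%:C *: set_val x)
    [set y | nrm (set_val (normalize x) - y) < e].
  by apply/nbhs_nrmP; exists e => // y; rewrite nE.
have /nbhs_nrmP[d d0 dP] := normalize_cvg (set_valP x) ne.
exists d => // y /dP /= xy; rewrite gE; apply: eU; first exact: set_valP (normalize y).
by rewrite [X in _ - X]nE.
Qed.

End PureStateTopologies.

(** * Rays and unit rays *)

Section RayMaps.
Local Open Scope quotient_scope.
Context (R : realType) (H : completeNormedModType R[i]).

Lemma ray_eqP (x y : nonzero_vectors H) :
  ray x = ray y <-> exists2 c : R[i], c != 0 & set_val x = c *: set_val y.
Proof.
split=> [/eqmodP/asboolP//|xy].
by apply/eqmodP/asboolP.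
Qed.

Lemma unit_ray_eqP (x y : unit_sphere H) :
  unit_ray x = unit_ray y <-> exists2 c : R[i], `|c| = 1 & set_val x = c *: set_val y.
Proof.
split=> [/eqmodP/asboolP//|xy].
by apply/eqmodP/asboolP.
Qed.

Definition ray_repr (r : projective_space H) : nonzero_vectors H :=
  repr (r : {eq_quot ray_equiv_rel H}).

Lemma ray_reprK r : ray (ray_repr r) = r.
Proof. exact: reprK. Qed.

Definition unit_ray_repr (r : unit_rays H) : unit_sphere H :=
  repr (r : {eq_quot phase_equiv_rel H}).

Lemma unit_ray_reprK r : unit_ray (unit_ray_repr r) = r.
Proof. exact: reprK. Qed.

Lemma set_val_normalize (x : nonzero_vectors H) :
  set_val (normalize x) = `|set_val x|^-1 *: set_val x.
Proof. by []. Qed.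

Lemma nonzero_norm (x : nonzero_vectors H) : `|set_val x| != 0.
Proof. by rewrite normr_eq0; exact: (set_valP x). Qed.

Lemma unit_sphere_nonzero (x : unit_sphere H) : set_val x \in nonzero_vectors H.
Proof.
apply/mem_set; rewrite /nonzero_vectors /= -normr_eq0.
by rewrite (set_valP x : `|set_val x| = 1) oner_eq0.
Qed.

Definition nonzero_of_unit (x : unit_sphere H) : nonzero_vectors H :=
  exist _ (set_val x) (unit_sphere_nonzero x).

Lemma ray_normalize (x : nonzero_vectors H) :
  ray (nonzero_of_unit (normalize x)) = ray x.
Proof.
apply/ray_eqP; exists (`|set_val x|^-1) => //.
by rewrite invr_eq0 nonzero_norm.
Qed.

Lemma normalize_nonzero_of_unit (x : unit_sphere H) :
  normalize (nonzero_of_unit x) = x.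
Proof.
apply: val_inj; rewrite -!set_valE set_val_normalize.
rewrite -[set_val (nonzero_of_unit x)]/(set_val x).
by rewrite (set_valP x : `|set_val x| = 1) invr1 scale1r.
Qed.

Definition unit_ray_of_ray (r : projective_space H) : unit_rays H :=
  unit_ray (normalize (ray_repr r)).

Definition ray_of_unit_ray (r : unit_rays H) : projective_space H :=
  ray (nonzero_of_unit (unit_ray_repr r)).

(** Independence of the chosen representative: if it is [c x], normalizing leaves the phase
    [c / |c|]. *)
Lemma unit_ray_of_rayE (x : nonzero_vectors H) :
  unit_ray_of_ray (ray x) = unit_ray (normalize x).
Proof.
have /ray_eqP[c c0 yE] := ray_reprK (ray x).
apply/unit_ray_eqP; exists (c / `|c|).
  by rewrite normrM normfV normr_id mulfV// normr_eq0.
rewrite !set_val_normalize yE normrZ invfM !scalerA; congr (_ *: _).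
by rewrite [_ * c]mulrC mulrA.
Qed.

Lemma ray_of_unit_rayE (x : unit_sphere H) :
  ray_of_unit_ray (unit_ray x) = ray (nonzero_of_unit x).
Proof.
have /unit_ray_eqP[c c1 yE] := unit_ray_reprK (unit_ray x).
by apply/ray_eqP; exists c => //; rewrite -normr_eq0 c1 oner_eq0.
Qed.

Lemma unit_ray_of_ray_bij : bijective unit_ray_of_ray.
Proof.
exists ray_of_unit_ray => r.
  rewrite -(ray_reprK r).
  by rewrite unit_ray_of_rayE ray_of_unit_rayE ray_normalize.
rewrite -(unit_ray_reprK r).
by rewrite ray_of_unit_rayE unit_ray_of_rayE normalize_nonzero_of_unit.
Qed.

End RayMaps.

Theorem mainTheorem1 (R : realType) (H : completeNormedModType R[i])
    (ip : {dot H for Num.conj})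
    (ip_norm : forall x : H, ip x x = `|x| ^+ 2)
    (H_separable : separable_space H)
    (H_nontrivial : exists x : H, x != 0) :
  exists (f : projective_space H -> unit_rays H)
         (g : unit_rays H -> pure_states ip),
    [/\ (forall x : nonzero_vectors H, f (ray x) = unit_ray (normalize x)),
        bijective f,
        (forall x : unit_sphere H, set_val (g (unit_ray x)) = rank_one ip (set_val x)),
        bijective g &
        [/\ transport_topology (g \o f) (T_mu H) = transport_topology g (T_nu H),
            transport_topology g (T_nu H) = T_0 ip
          & [/\ T_0 ip = T_w ip, T_w ip = T_1 ip, T_1 ip = T_2 ip
              & [/\ T_2 ip = T_3 ip, T_3 ip = T_4 ip, T_4 ip = T_5 ip
                  & [/\ T_5 ip = T_s ip, T_s ip = T_n ip & T_n ip = T_tr ip]]]]].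
Proof.
have [x0 x0_neq0] := H_nontrivial.
pose u0 := normalize (exist _ x0 (mem_set (x0_neq0 : nonzero_vectors H x0))).
pose p0 : pure_states ip :=
  exist (fun A => A \in pure_states ip) _
    (mem_set (pure_rank_one ip_norm H_separable (set_valP u0))).
(* The default [p0], obtained from a nonzero vector, is returned when [rank_one ip x] is not a pure
   state; this never happens for unit [x]. *)
pose pr x : pure_states ip := insubd p0 (rank_one ip x).
have prE x : `|x| = 1 -> set_val (pr x) = rank_one ip x.
  move=> x1; rewrite set_valE /= /pr insubdK//.
  by apply/mem_set; exact: pure_rank_one.
pose g (r : unit_rays H) : pure_states ip := pr (set_val (unit_ray_repr r)).
have gE (x : unit_sphere H) : g (unit_ray x) = pr (set_val x).
  rewrite /g; have /unit_ray_eqP[c c1 ->] := unit_ray_reprK (unit_ray x).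
  exact: (pr_phase prE c1 (set_valP x)).
have pr_inj (x y : unit_sphere H) : pr (set_val x) = pr (set_val y) -> unit_ray x = unit_ray y.
  move=> xy; apply/unit_ray_eqP.
  apply: (rank_one_inj ip_norm (set_valP x) (set_valP y)).
  by rewrite -(prE _ (set_valP x)) xy (prE _ (set_valP y)).
(* A chosen unit representative of each pure state, from which the inverse of [g] is built. *)
have pr_sphere p : {x : unit_sphere H | p = pr (set_val x)}.
  apply: cid; have [x x1 ->] := pr_surj ip_norm H_separable prE p.
  by exists (exist _ x (mem_set (x1 : unit_sphere H x))).
exists (@unit_ray_of_ray R H), g; split.
- exact: unit_ray_of_rayE.
- exact: unit_ray_of_ray_bij.
- by move=> x; rewrite gE prE//; exact: (set_valP x).
- exists (fun p => unit_ray (sval (pr_sphere p))) => [r|p].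
    rewrite -(unit_ray_reprK r) gE.
    by case: (pr_sphere _) => y /= /pr_inj.
  by case: (pr_sphere p) => x /= ->; rewrite gE.
- have T_w' := T_wE ip_norm H_separable prE.
  have T_s' := T_sE ip_norm H_separable prE.
  have T_0' := T_0E ip_norm H_separable prE.
  have T_1' := T_1E ip_norm H_separable prE.
  have T_2' := T_2E ip_norm H_separable prE.
  have T_3' := T_3E ip_norm H_separable prE.
  have T_4' := T_4E ip_norm H_separable prE.
  have T_5' := T_5E ip_norm H_separable prE.
  have T_tr' := T_trE ip_norm H_separable prE.
  have T_nu' := T_nuE ip_norm H_separable prE gE.
  have T_mu' := @T_muE R H ip ip_norm H_separable pr prE (g \o @unit_ray_of_ray R H).
  rewrite T_nu' T_mu' ?T_w' ?T_s' ?T_0' ?T_1' ?T_2' ?T_3' ?T_4' ?T_5' ?T_tr'//.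
  by move=> x; rewrite /= unit_ray_of_rayE gE.
Qed.
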